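(* Let $\gamma\in[0,2]$, $\beta\in(0,3-\gamma]$, let $q:\mathbb{R}^d\to\mathbb{R}^d$ be continuous and let $c:\mathbb{R}^d\to\mathbb{R}$ be continuous with $c<0$. Suppose that $\mathcal{V}:\mathbb{R}^d\to[0,\infty)$ is a locally Lipschitz function with $\liminf_{|x|\to\infty}\mathcal{V}(x)>0$ satisfying, in the viscosity sense, $$\Delta_\infty^\gamma\mathcal{V}+q(x)\cdot\nabla\mathcal{V}\,|\nabla\mathcal{V}|^{2-\gamma}+c(x)\mathcal{V}^\beta\le0\quad\text{in }\mathbb{R}^d.$$ Let $u\in C(\mathbb{R}^d)$ satisfy, in the viscosity sense, $$\Delta_\infty^\gamma u+q(x)\cdot\nabla u\,|\nabla u|^{2-\gamma}+c(x)(u_+)^\beta\ge0\quad\text{in }\mathbb{R}^d.$$ If $$\lim_{|x|\to\infty}\frac{u_+(x)}{\mathcal{V}(x)}=0,$$ then $u\le0$ (in particular, if $u\ge0$, then $u\equiv0$). In addition, if we also assume that $\limsup_{|x|\to\infty}(q(x)\cdot x)_+<1$, then $u$ is a constant.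
   Context: $t_+=\max\{t,0\}$. For a $C^2$ function $\varphi$, $\Delta_\infty^\gamma\varphi=|\nabla\varphi|^{-\gamma}\sum_{i,j=1}^d\partial_{x_i}\varphi\,\partial_{x_ix_j}\varphi\,\partial_{x_j}\varphi$. Viscosity sense: consider an equation $\Delta_\infty^\gamma u+G(x,u,\nabla u)=0$ in an open set $U\subset\mathbb{R}^d$ with $G$ continuous. An upper-semicontinuous $u$ is a subsolution (satisfies the inequality $\ge0$) if, whenever $x_0\in U$ and $\varphi$ is $C^2$ near $x_0$ with $u(x_0)=\varphi(x_0)$ and $u<\varphi$ in a punctured ball around $x_0$, one has $\Delta_\infty^\gamma\varphi(x_0)+G(x_0,u(x_0),\nabla\varphi(x_0))\ge0$; if $\nabla\varphi(x_0)=0$, the term $\Delta_\infty^\gamma\varphi(x_0)$ is read as $0$ when $\gamma<2$ and as $M(D^2\varphi(x_0))=\max_{|\xi|=1}\langle\xi,D^2\varphi(x_0)\xi\rangle$ when $\gamma=2$. A lower-semicontinuous $u$ is a supersolution (satisfies $\le0$) if, whenever $\varphi$ is $C^2$ near $x_0$ with $u(x_0)=\varphi(x_0)$ and $u>\varphi$ in a punctured ball around $x_0$, one has $\Delta_\infty^\gamma\varphi(x_0)+G(x_0,u(x_0),\nabla\varphi(x_0))\le0$; if $\nabla\varphi(x_0)=0$, $\Delta_\infty^\gamma\varphi(x_0)$ is read as $0$ when $\gamma<2$ and as $m(D^2\varphi(x_0))=\min_{|\xi|=1}\langle\xi,D^2\varphi(x_0)\xi\rangle$ when $\gamma=2$.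 *)

(* Defs.v *)
From mathcomp Require Import all_boot all_order all_algebra.
From mathcomp Require Import all_classical all_reals all_analysis.

Set Implicit Arguments.
Unset Strict Implicit.
Unset Printing Implicit Defensive.

Import Order.TTheory GRing.Theory Num.Theory.
Import numFieldNormedType.Exports.

Local Open Scope classical_set_scope.
Local Open Scope ring_scope.

(* The norm `|x| that the library puts on 'rV[R]_d is the sup norm.  It induces
   the usual topology, and the usual locally Lipschitz functions, but |.| in
   the formulas below is Euclidean. *)
Definition dot (R : realType) (d : nat) (x y : 'rV[R]_d) : R :=
  \sum_(i < d) x 0 i * y 0 i.

Definition enorm (R : realType) (d : nat) (x : 'rV[R]_d) : R :=
  Num.sqrt (dot x x).

(* The filter |x| --> +oo on R^d. *)
Definition at_infinity (R : realType) (d : nat) : set_system 'rV[R]_d :=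
  filter_from [set: R] (fun r => [set x | r < enorm x]).
Arguments at_infinity {R d}.

Definition pos_part (R : realType) (t : R) : R := Num.max t 0.

Definition partial (R : realType) (d : nat) (i : 'I_d) (f : 'rV[R]_d -> R) :
  'rV[R]_d -> R := fun x => 'D_(delta_mx 0 i) f x.

Definition grad (R : realType) (d : nat) (f : 'rV[R]_d -> R) (x : 'rV[R]_d) :
  'rV[R]_d := \row_i partial i f x.

Definition hessian (R : realType) (d : nat) (f : 'rV[R]_d -> R)
  (x : 'rV[R]_d) : 'M[R]_d := \matrix_(i, j) partial i (partial j f) x.

Definition C2_near (R : realType) (d : nat) (f : 'rV[R]_d -> R)
    (x0 : 'rV[R]_d) : Prop :=
  \forall x \near x0,
    [/\ {for x, continuous f},
        forall i : 'I_d, derivable f x (delta_mx 0 i) /\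
          {for x, continuous (partial i f)} &
        forall i j : 'I_d, derivable (partial j f) x (delta_mx 0 i) /\
          {for x, continuous (partial i (partial j f))}].

(* The sphere |xi| = 1 is compact, and nonempty when 0 < d, so this sup is a
   maximum and the inf below is a minimum. *)
Definition max_quad (R : realType) (d : nat) (H : 'M[R]_d) : R :=
  sup [set (xi *m H *m xi^T) 0 0 | xi in [set xi : 'rV[R]_d | enorm xi = 1]].

Definition min_quad (R : realType) (d : nat) (H : 'M[R]_d) : R :=
  inf [set (xi *m H *m xi^T) 0 0 | xi in [set xi : 'rV[R]_d | enorm xi = 1]].

Definition inf_lap (R : realType) (d : nat) (gamma : R) (f : 'rV[R]_d -> R)
    (x : 'rV[R]_d) : R :=
  enorm (grad f x) `^ (- gamma) *
  \sum_(i < d) \sum_(j < d) partial i f x * hessian f x i j * partial j f x.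

Definition inf_lap_sub (R : realType) (d : nat) (gamma : R)
    (f : 'rV[R]_d -> R) (x : 'rV[R]_d) : R :=
  if grad f x != 0 then inf_lap gamma f x
  else if gamma < 2 then 0 else max_quad (hessian f x).

Definition inf_lap_super (R : realType) (d : nat) (gamma : R)
    (f : 'rV[R]_d -> R) (x : 'rV[R]_d) : R :=
  if grad f x != 0 then inf_lap gamma f x
  else if gamma < 2 then 0 else min_quad (hessian f x).

(* Viscosity solutions of inf_lap gamma u + G(x, u, grad u) >= 0 (resp. <= 0)
   in the whole space.  Upper semicontinuity of u is lower semicontinuity of
   - u, and x0^' is the filter of punctured neighbourhoods of x0. *)
Definition visc_subsolution (R : realType) (d : nat) (gamma : R)
    (G : 'rV[R]_d -> R -> 'rV[R]_d -> R) (u : 'rV[R]_d -> R) : Prop :=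
  lower_semicontinuous (fun x => (- u x)%:E) /\
  forall (x0 : 'rV[R]_d) (phi : 'rV[R]_d -> R),
    C2_near phi x0 -> u x0 = phi x0 -> (\forall x \near x0^', u x < phi x) ->
    0 <= inf_lap_sub gamma phi x0 + G x0 (u x0) (grad phi x0).

Definition visc_supersolution (R : realType) (d : nat) (gamma : R)
    (G : 'rV[R]_d -> R -> 'rV[R]_d -> R) (u : 'rV[R]_d -> R) : Prop :=
  lower_semicontinuous (fun x => (u x)%:E) /\
  forall (x0 : 'rV[R]_d) (phi : 'rV[R]_d -> R),
    C2_near phi x0 -> u x0 = phi x0 -> (\forall x \near x0^', phi x < u x) ->
    inf_lap_super gamma phi x0 + G x0 (u x0) (grad phi x0) <= 0.

(* Main.v *)
Require Import Defs.
From mathcomp Require Import all_boot all_order all_algebra.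
From mathcomp Require Import all_classical all_reals all_analysis.
From mathcomp Require Import ring lra.
Import Order.TTheory GRing.Theory Num.Theory.
Import numFieldNormedType.Exports.
Local Open Scope classical_set_scope.
Local Open Scope ring_scope.

(* The comparison u <= theta V is obtained without the Jensen-Ishii theorem on
sums, using that the infinity Laplacian only sees second derivatives along the
gradient.  Double the variables: let (x, y) maximize u(z) - theta V(w) - N |z - w|^4
and let m be the midpoint of x and y.  If x = y, then u is touched from above by a
quartic with vanishing 2-jet, so c(x) u(x)^beta >= 0, which is impossible.  Otherwise u,
restricted to the balls around m, has its maximum over the ball through x exactly
at x, so near x it can be tested with polynomials of degree 2 in T = |z - m|^2.
The equation prevents such a polynomial from touching u near x unless its second
coefficient k is large, hence the maximum of u over spheres around m is k-convex
in T.  The same holds for - theta V near y, on the same spheres.  Pairing the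
outer sphere for u with the inner one for theta V, and conversely, the doubled
maximum bounds the sum of the two second differences, and this yields
  0 <= |p|^(2 - gamma) (q(x) - q(y)).p + c(x) u(x)^beta - c(y) (theta V(y))^beta,
with |p| = 4 N |x - y|^3 bounded by the Lipschitz constant of theta V.  As N grows
this contradicts c < 0.  Letting theta tend to 0 gives u <= 0.

For the Liouville property, the barrier eps ln |x| shows that u attains its
maximum, and the strong maximum principle, proved with the same polynomials in
|z - m|^2 as barriers at a boundary point of an interior touching ball, shows
that u is constant. *)

(** * Euclidean geometry *)

Section Dot.
Context {R : realType} {d : nat}.
Implicit Types (x y z m : 'rV[R]_d) (a b : R).

Lemma dotC x y : dot x y = dot y x.
Proof. by apply: eq_bigr => i _; rewrite mulrC. Qed.

Lemma dotDr x y z : dot x (y + z) = dot x y + dot x z.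
Proof. by rewrite /dot -big_split; apply: eq_bigr => i _; rewrite mxE mulrDr. Qed.

Lemma dotZr a x y : dot x (a *: y) = a * dot x y.
Proof. by rewrite /dot big_distrr; apply: eq_bigr => i _; rewrite /= mxE; ring. Qed.

Lemma dotNr x y : dot x (- y) = - dot x y.
Proof. by rewrite -scaleN1r dotZr mulN1r. Qed.

Lemma dotDl x y z : dot (x + y) z = dot x z + dot y z.
Proof. by rewrite dotC dotDr !(dotC z). Qed.

Lemma dotZl a x y : dot (a *: x) y = a * dot x y.
Proof. by rewrite dotC dotZr dotC. Qed.

Lemma dotNl x y : dot (- x) y = - dot x y.
Proof. by rewrite dotC dotNr dotC. Qed.

Lemma dot0l x : dot 0 x = 0.
Proof. by rewrite -(scale0r 0) dotZl mul0r. Qed.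

Lemma dot0r x : dot x 0 = 0.
Proof. by rewrite dotC dot0l. Qed.

Definition dotE := (dotDl, dotDr, dotNl, dotNr, dotZl, dotZr, dot0l, dot0r).

Lemma dot_ge0 x : 0 <= dot x x.
Proof. by apply: sumr_ge0 => i _; rewrite -expr2 sqr_ge0. Qed.

Lemma coord_sqr_le x i : x 0 i ^+ 2 <= dot x x.
Proof.
rewrite /dot (bigD1 i)//= -expr2 lerDl.
by apply: sumr_ge0 => j _; rewrite -expr2 sqr_ge0.
Qed.

Lemma dot_eq0 x : (dot x x == 0) = (x == 0).
Proof.
apply/eqP/eqP => [x0|->]; last by rewrite dot0l.
apply/rowP => i; rewrite mxE; apply/eqP.
by rewrite -sqrf_eq0 eq_le sqr_ge0 andbT -x0 coord_sqr_le.
Qed.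

Lemma dot_gt0 x : (0 < dot x x) = (x != 0).
Proof. by rewrite lt_neqAle dot_ge0 andbT eq_sym dot_eq0. Qed.

Lemma cauchy_schwarz x y : dot x y ^+ 2 <= dot x x * dot y y.
Proof.
have [->|y0] := eqVneq y 0; first by rewrite !dotE expr0n/= mulr0.
have {}y0 : 0 < dot y y by rewrite dot_gt0.
have := dot_ge0 (dot y y *: x - dot x y *: y).
rewrite !dotE (dotC y x).
rewrite [X in 0 <= X](_ : _ = dot y y * (dot x x * dot y y - dot x y ^+ 2)); last by ring.
by rewrite pmulr_rge0// subr_ge0.
Qed.

Lemma sqr_enorm x : enorm x ^+ 2 = dot x x.
Proof. by rewrite sqr_sqrtr// dot_ge0. Qed.

Lemma enorm_ge0 x : 0 <= enorm x.
Proof. exact: sqrtr_ge0. Qed.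

Lemma enorm_gt0 x : (0 < enorm x) = (x != 0).
Proof. by rewrite sqrtr_gt0 dot_gt0. Qed.

Lemma enormZ a x : enorm (a *: x) = `|a| * enorm x.
Proof.
by rewrite /enorm !dotE mulrA -expr2 sqrtrM ?sqr_ge0// sqrtr_sqr.
Qed.

Lemma normr_dot_le x y : `|dot x y| <= enorm x * enorm y.
Proof.
rewrite -ler_sqr ?nnegrE ?mulr_ge0 ?enorm_ge0//.
by rewrite exprMn !sqr_enorm real_normK ?num_real// cauchy_schwarz.
Qed.

Definition sqdist m x := dot (x - m) (x - m).

Lemma sqdist_ge0 m x : 0 <= sqdist m x. Proof. exact: dot_ge0. Qed.

Lemma sqdistC m x : sqdist m x = sqdist x m.
Proof. by rewrite /sqdist -(opprB x m) dotNl dotNr opprK. Qed.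

Lemma sqdist_gt0 m x : (0 < sqdist m x) = (x != m).
Proof. by rewrite /sqdist dot_gt0 subr_eq0. Qed.

Lemma sqdistxx x : sqdist x x = 0.
Proof. by rewrite /sqdist subrr dot0l. Qed.

Lemma sqdist_parallelogram m x y : sqdist x y =
  2 * sqdist m x + 2 * sqdist m y - sqdist (2 *: m - x) y.
Proof.
rewrite /sqdist !dotE (dotC m x) (dotC m y) (dotC y x); ring.
Qed.

Lemma sqdistD m x y : sqdist x y <= 2 * sqdist m x + 2 * sqdist m y.
Proof. by rewrite (sqdist_parallelogram m) gerBl sqdist_ge0. Qed.

Lemma sqdist_midpoint x y :
  sqdist (2^-1 *: (x + y)) x = sqdist x y / 4.
Proof. by rewrite /sqdist !dotE (dotC y x); field. Qed.

(* Cauchy-Schwarz for x - y and x + y - 2m, whose product is 2t. *)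
Lemma sqdist_opposite m x y a t : 0 < a ->
  sqdist m x = a + t -> sqdist m y = a - t -> sqdist x y <= 4 * a - t ^+ 2 / a.
Proof.
move=> a0 xt yt.
have E := sqdist_parallelogram m x y; rewrite xt yt in E.
have l4 : sqdist x y <= 4 * a by have := sqdist_ge0 (2 *: m - x) y; lra.
have cs := cauchy_schwarz (x - y) (x + y - 2 *: m).
have e1 : dot (x - y) (x + y - 2 *: m) = 2 * t.
  rewrite (_ : 2 * t = sqdist m x - sqdist m y); last by rewrite xt yt; ring.
  by rewrite /sqdist !dotE (dotC y x) (dotC m x) (dotC m y); ring.
have e2 : dot (x + y - 2 *: m) (x + y - 2 *: m) = sqdist (2 *: m - x) y.
  by rewrite /sqdist; congr dot; rewrite opprB addrCA addrA.
rewrite e1 e2 in cs.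
have e3 : dot (x - y) (x - y) = sqdist x y by rewrite sqdistC.
rewrite e3 in cs.
have S0 := sqdist_ge0 (2 *: m - x) y.
suff : t ^+ 2 / a <= sqdist (2 *: m - x) y by lra.
rewrite ler_pdivrMr//.
have : (2 * t) ^+ 2 <= 4 * a * sqdist (2 *: m - x) y.
  by apply: le_trans cs _; rewrite ler_wpM2r.
rewrite exprMn; lra.
Qed.

End Dot.

(** * Topology and test functions *)

Section Topology.
Context {R : realType} {d : nat}.
Implicit Types (x y z m v w : 'rV[R]_d) (A : set 'rV[R]_d).

Lemma cvg_dot {T} {F : set_system T} {FF : Filter F} (f g : T -> 'rV[R]_d) x y :
  f @ F --> x -> g @ F --> y -> dot (f t) (g t) @[t --> F] --> dot x y.
Proof.
move=> fx gy; apply: (@cvg_big R _ +%R 0 xpredT _ _ _ _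
  (fun i t => f t 0 i * g t 0 i) (fun i => x 0 i * y 0 i)) => [|i _].
  exact: add_continuous.
have cc (z : 'rV[R]_d) : (fun M : 'rV[R]_d => M 0 i) w @[w --> z] --> z 0 i.
  exact: coord_continuous.
by apply: cvgM; [exact: (cvg_comp _ _ fx (cc x))|exact: (cvg_comp _ _ gy (cc y))].
Qed.

Lemma cvg_sqdist {T} {F : set_system T} {FF : Filter F} (f : T -> 'rV[R]_d) m x :
  f @ F --> x -> sqdist m (f t) @[t --> F] --> sqdist m x.
Proof. by move=> fx; apply: cvg_dot; (apply: cvgB; [exact: fx|exact: cvg_cst]). Qed.

Lemma sqdist_continuous m : continuous (sqdist m).
Proof. by move=> x; apply: (@cvg_sqdist _ (nbhs x)); exact: cvg_id. Qed.

(** Every coordinate is bounded by the Euclidean norm, so Euclidean balls lie in the sup-norm balls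
    that generate the topology. *)
Lemma near_sqdist x A : (\forall z \near x, A z) ->
  exists2 e, 0 < e & forall z, sqdist x z < e -> A z.
Proof.
move=> /nbhs_ballP[e /= e0 eA]; exists (e ^+ 2); first by rewrite exprn_gt0.
move=> z zx; apply: eA; split => // i j; rewrite ord1 /ball/=.
rewrite -(@ltr_pXn2r _ 2%N) ?nnegrE ?(ltW e0)// real_normK ?num_real//.
apply: le_lt_trans zx; have := coord_sqr_le (z - x) j.
by rewrite !mxE -sqrrN opprB.
Qed.

Lemma sqdist_near x e : 0 < e -> \forall z \near x, sqdist x z < e.
Proof.
move=> e0; have /(_ x) := sqdist_continuous x.
by rewrite /continuous_at sqdistxx => /cvgr_lt; apply.
Qed.

Lemma closed_sqdist_le m (c : R) : closed [set x | sqdist m x <= c].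
Proof.
apply: (@closed_comp _ _ (sqdist m) [set r | r <= c]); last exact: closed_le.
by move=> x _; exact: sqdist_continuous.
Qed.

Lemma closed_sqdist_ge m (c : R) : closed [set x | c <= sqdist m x].
Proof.
apply: (@closed_comp _ _ (sqdist m) [set r | c <= r]); last exact: closed_ge.
by move=> x _; exact: sqdist_continuous.
Qed.

Lemma compact_sqdist_le m (c : R) : compact [set x | sqdist m x <= c].
Proof.
apply: bounded_closed_compact; last exact: closed_sqdist_le.
(* Coordinates of [x - m] have square at most [c], and [1 + c] dominates the root of [c]. *)
exists (`|m| + (1 + c)); split; first by rewrite num_real.
move=> M cM x /= xc; apply: le_trans (ltW cM).
rewrite -(subrKC m x) (le_trans (ler_normD _ _))// lerD2l.
have c0 : 0 <= c by rewrite (le_trans (sqdist_ge0 m x)).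
rewrite [leLHS]/Num.Def.normr/= mx_normrE (bigmax_le _ _)//=; first lra.
move=> [i j] _ /=; rewrite ord1.
have := coord_sqr_le (x - m) j; set t := (x - m) 0 j => tx.
have t2 : t ^+ 2 <= c by rewrite (le_trans tx).
rewrite -(@ler_pXn2r _ 2%N) ?nnegrE//; last lra.
by rewrite real_normK ?num_real//; nra.
Qed.

Lemma continuous_max_on (f : 'rV[R]_d -> R) A : A !=set0 -> compact A ->
  continuous f -> exists2 a, A a & forall x, A x -> f x <= f a.
Proof.
move=> A0 cA cf; have [|a + am] := EVT_max_rV (f := f) A0 cA.
  exact: continuous_subspaceT.
by rewrite inE => Aa; exists a => // x Ax; apply: am; rewrite inE.
Qed.

End Topology.

(** * Polynomial test functions and their 2-jets *)

Section TestFunctions.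
Context {R : realType} {d : nat}.
Implicit Types (x y z m v w : 'rV[R]_d).

Lemma is_derive_coord x v j : is_derive x v (fun z : 'rV[R]_d => z 0 j) (v 0 j).
Proof.
have did := @derivable_id _ _ x v.
apply: DeriveDef; first exact: (derivable_mxP id x v).1 did 0 j.
have := derive_mx did; rewrite derive_id => /matrixP/(_ 0 j).
by rewrite mxE => <-.
Qed.

Lemma is_derive_dot m w x v :
  is_derive x v (fun z => dot (z - m) w) (dot v w).
Proof.
rewrite (_ : (fun z => _) =
  \sum_(i < d) (fun z : 'rV[R]_d => (z 0 i - m 0 i) * w 0 i)); last first.
  by apply/funext => z; rewrite fct_sumE; apply: eq_bigr => i _; rewrite !mxE.
apply: is_derive_sum => i.
have D := is_deriveM (is_deriveB (is_derive_coord x v i)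
  (is_derive_cst (m 0 i : R) x v)) (is_derive_cst (w 0 i : R) x v).
by apply: is_derive_eq D _; rewrite scaler0 add0r subr0 /GRing.scale/= mulrC.
Qed.

Lemma is_derive_sqdist m x v :
  is_derive x v (sqdist m) (2 * dot (x - m) v).
Proof.
rewrite (_ : sqdist m =
  \sum_(i < d) (fun z : 'rV[R]_d => (z 0 i - m 0 i) * (z 0 i - m 0 i))); last first.
  by apply/funext => z; rewrite fct_sumE; apply: eq_bigr => i _; rewrite !mxE.
rewrite /dot big_distrr/=.
apply: is_derive_sum => i.
have D := is_deriveB (is_derive_coord x v i) (is_derive_cst (m 0 i : R) x v).
apply: is_derive_eq (is_deriveM D D) _.
by rewrite /GRing.scale/= !mxE !fctE /=; ring.
Qed.

(* The term in l makes a touching strict, and does not change the 2-jet at y. *)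
Definition quartic (A s k l : R) m y z :=
  A + s * (sqdist m z - sqdist m y) + k / 2 * (sqdist m z - sqdist m y) ^+ 2
  + l * sqdist y z ^+ 2.

(** The derivative of [quartic] in the direction [v]; [quartic''] differentiates once more, in the
    direction [w]. *)
Definition quartic' (s k l : R) m y v z :=
  2 * (s + k * (sqdist m z - sqdist m y)) * dot (z - m) v
  + 4 * l * sqdist y z * dot (z - y) v.

Definition quartic'' (s k l : R) m y v w z :=
  4 * k * dot (z - m) w * dot (z - m) v
  + 2 * (s + k * (sqdist m z - sqdist m y)) * dot w v
  + 8 * l * dot (z - y) w * dot (z - y) v + 4 * l * sqdist y z * dot w v.

Lemma is_derive_quartic A s k l m y v x :
  is_derive x v (quartic A s k l m y) (quartic' s k l m y v x).
Proof.
pose c (a : R) : 'rV[R]_d -> R := cst a.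
have dc a : is_derive x v (c a) 0 by exact: is_derive_cst.
have dT := is_deriveB (is_derive_sqdist m x v) (dc (sqdist m y)).
have dY := is_derive_sqdist y x v.
have D := is_deriveD (is_deriveD (is_deriveD (dc A) (is_deriveM (dc s) dT))
  (is_deriveM (dc (k / 2)) (is_deriveM dT dT)))
  (is_deriveM (dc l) (is_deriveM dY dY)).
rewrite (_ : quartic _ _ _ _ _ _ =
   (((c A + (c s * (sqdist m - c (sqdist m y))))
    + c (k / 2) * ((sqdist m - c (sqdist m y)) * (sqdist m - c (sqdist m y))))
    + c l * (sqdist y * sqdist y))); last first.
  by apply/funext => z; rewrite /quartic !fctE /c /=; ring.
apply: is_derive_eq D _.
by rewrite /quartic' /c /GRing.scale/= !fctE/=; field.
Qed.

Lemma is_derive_quartic' s k l m y v w x :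
  is_derive x w (quartic' s k l m y v) (quartic'' s k l m y v w x).
Proof.
pose c (a : R) : 'rV[R]_d -> R := cst a.
have dc a : is_derive x w (c a) 0 by exact: is_derive_cst.
have dT := is_deriveB (is_derive_sqdist m x w) (dc (sqdist m y)).
have dY := is_derive_sqdist y x w.
have D := is_deriveD (is_deriveM (is_deriveM (dc 2)
   (is_deriveD (dc s) (is_deriveM (dc k) dT))) (is_derive_dot m v x w))
  (is_deriveM (is_deriveM (dc (4 * l)) dY) (is_derive_dot y v x w)).
rewrite (_ : quartic' _ _ _ _ _ _ =
   ((c 2 * (c s + c k * (sqdist m - c (sqdist m y)))) * (fun z => dot (z - m) v)
    + (c (4 * l) * sqdist y) * (fun z => dot (z - y) v))); last first.
  by apply/funext => z; rewrite /quartic' !fctE /c /=; ring.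
apply: is_derive_eq D _.
by rewrite /quartic'' /c /GRing.scale/= !fctE/=; ring.
Qed.

Lemma cvg_dot_sub m v x : dot (z - m) v @[z --> x] --> dot (x - m) v.
Proof.
apply: (@cvg_dot _ _ _ (nbhs x)); last exact: cvg_cst.
by apply: cvgB; [exact: cvg_id|exact: cvg_cst].
Qed.

Lemma sqdist_sub_continuous m y x :
  sqdist m z - sqdist m y @[z --> x] --> sqdist m x - sqdist m y.
Proof. exact: cvgB (sqdist_continuous m x) (cvg_cst _). Qed.

Lemma quartic_continuous A s k l m y x : {for x, continuous (quartic A s k l m y)}.
Proof.
have T := @sqdist_sub_continuous m y x.
have Y := @sqdist_continuous _ _ y x.
have C a := @cvg_cst R a 'rV[R]_d (nbhs x) (nbhs_filter x).
exact: (cvgD (cvgD (cvgD (C A) (cvgM (C s) T)) (cvgM (C (k / 2)) (cvgM T T)))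
  (cvgM (C l) (cvgM Y Y))).
Qed.

Lemma quartic'_continuous s k l m y v x : {for x, continuous (quartic' s k l m y v)}.
Proof.
have T := @sqdist_sub_continuous m y x.
have Y := @sqdist_continuous _ _ y x.
have C a := @cvg_cst R a 'rV[R]_d (nbhs x) (nbhs_filter x).
exact: (cvgD (cvgM (cvgM (C 2) (cvgD (C s) (cvgM (C k) T))) (@cvg_dot_sub m v x))
  (cvgM (cvgM (C (4 * l)) Y) (@cvg_dot_sub y v x))).
Qed.

Lemma quartic''_continuous s k l m y v w x : {for x, continuous (quartic'' s k l m y v w)}.
Proof.
have T := @sqdist_sub_continuous m y x.
have Y := @sqdist_continuous _ _ y x.
have C a := @cvg_cst R a 'rV[R]_d (nbhs x) (nbhs_filter x).
have D := @cvg_dot_sub.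
exact: (cvgD (cvgD (cvgD (cvgM (cvgM (C (4 * k)) (D m w x)) (D m v x))
  (cvgM (cvgM (C 2) (cvgD (C s) (cvgM (C k) T))) (C (dot w v))))
  (cvgM (cvgM (C (8 * l)) (D y w x)) (D y v x)))
  (cvgM (cvgM (C (4 * l)) Y) (C (dot w v)))).
Qed.

Lemma partial_quartic A s k l m y i :
  partial i (quartic A s k l m y) = quartic' s k l m y (delta_mx 0 i).
Proof.
by apply/funext => z; have D := is_derive_quartic A s k l m y (delta_mx 0 i) z;
  rewrite /partial derive_val.
Qed.

Lemma partial_quartic' s k l m y v i :
  partial i (quartic' s k l m y v) = quartic'' s k l m y v (delta_mx 0 i).
Proof.
by apply/funext => z; have D := is_derive_quartic' s k l m y v (delta_mx 0 i) z;
  rewrite /partial derive_val.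
Qed.

Lemma C2_quartic A s k l m y x : C2_near (quartic A s k l m y) x.
Proof.
apply: (@nearW _ (nbhs x) _ (nbhs_filter x)) => z; split.
  exact: quartic_continuous.
- move=> i; rewrite partial_quartic; split; last exact: quartic'_continuous.
  by have := is_derive_quartic A s k l m y (delta_mx 0 i) z; case.
- move=> i j; rewrite partial_quartic partial_quartic'; split.
    have := is_derive_quartic' s k l m y (delta_mx 0 j) (delta_mx 0 i) z.
    by case.
  exact: quartic''_continuous.
Qed.

Lemma dot_delta x i : dot x (delta_mx 0 i) = x 0 i.
Proof.
rewrite /dot (bigD1 i)//= big1 ?addr0 => [|j ji].
  by rewrite mxE !eqxx mulr1.
by rewrite mxE (negbTE ji) andbF mulr0.
Qed.

Lemma grad_quartic A s k l m y :
  grad (quartic A s k l m y) y = (2 * s) *: (y - m).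
Proof.
apply/rowP => i; rewrite mxE partial_quartic /quartic' subrr mulr0 addr0.
by rewrite sqdistxx mulr0 mul0r addr0 dot_delta [RHS]mxE.
Qed.

Lemma hessian_quartic A s k l m y i j : hessian (quartic A s k l m y) y i j =
  4 * k * (y - m) 0 i * (y - m) 0 j + 2 * s * (i == j)%:R.
Proof.
rewrite mxE partial_quartic partial_quartic' /quartic''.
rewrite !subrr !dot0l sqdistxx !dot_delta !mulr0 !mul0r !addr0.
by rewrite [delta_mx _ _ _ _]mxE eqxx/= eq_sym.
Qed.

End TestFunctions.

(** * Viscosity inequalities for polynomial test functions *)

Section QuadSub.
Context {R : realType} {d : nat}.
Implicit Types (x y z m v w g : 'rV[R]_d) (u V : 'rV[R]_d -> R).

(* The equation Delta_infty^gamma f + q.Df |Df|^(2 - gamma) + C >= 0 tested with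
   polynomials in T = |z - m|^2: the test function with first and second
   T-derivatives s and k at y has gradient p = 2 s (y - m) and infinity Laplacian
   |p|^(2 - gamma) (2 s + 4 k T(y)) there. *)
Definition quad_sub (gamma : R) (q : 'rV[R]_d -> 'rV[R]_d) (f C : 'rV[R]_d -> R) :=
  forall y m (s k : R), s != 0 -> y != m ->
  (\forall z \near y, f z <= f y + s * (sqdist m z - sqdist m y)
                             + k / 2 * (sqdist m z - sqdist m y) ^+ 2) ->
  0 <= enorm ((2 * s) *: (y - m)) `^ (2 - gamma) *
       (2 * s + 4 * k * sqdist m y + dot (q y) ((2 * s) *: (y - m))) + C y.

(** With [g = 2s (y - m)] the gradient, the Hessian at [y] is [2s] times the identity plus [4k]
    times the square of the form [dot (y - m)]; on [g] it takes the value
    [|g|^2 (2s + 4k |y - m|^2)]. *)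
Lemma inf_lap_quartic gamma A s k l m y : s != 0 -> y != m ->
  inf_lap gamma (quartic A s k l m y) y =
  enorm ((2 * s) *: (y - m)) `^ (2 - gamma) * (2 * s + 4 * k * sqdist m y).
Proof.
move=> s0 ym; set g := (2 * s) *: (y - m).
have g0 : 0 < enorm g.
  by rewrite enorm_gt0 scaler_eq0 negb_or mulf_neq0//= subr_eq0.
rewrite /inf_lap grad_quartic -/g addrC powRD; last by rewrite (gt_eqF g0) implybT.
rewrite (powR_mulrn 2)// ?ltW// -mulrA; congr (_ * _).
have pE i : partial i (quartic A s k l m y) y = g 0 i.
  by have /rowP/(_ i) := grad_quartic A s k l m y; rewrite mxE.
transitivity (4 * k * dot (y - m) g ^+ 2 + 2 * s * dot g g).
  transitivity (\sum_(i < d) (4 * k * ((y - m) 0 i * g 0 i) * dot (y - m) g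
      + 2 * s * (g 0 i * g 0 i))); last first.
    by rewrite big_split/= -mulr_suml -!mulr_sumr -/(dot (y - m) g) -/(dot g g); ring.
  apply: eq_bigr => i _; rewrite [dot (y - m) g]/dot mulr_sumr.
  under eq_bigr => j _.
    rewrite hessian_quartic !pE.
    rewrite (_ : _ * _ = 4 * k * ((y - m) 0 i * g 0 i) * ((y - m) 0 j * g 0 j)
      + 2 * s * g 0 i * (g 0 j * (i == j)%:R)); last by ring.
    over.
  rewrite big_split/=; congr (_ + _).
  rewrite (bigD1 i)//= eqxx mulr1 big1 ?addr0 ?mulrA// => j ji.
  by rewrite eq_sym (negbTE ji) !mulr0.
by rewrite sqr_enorm /g !(dotZl, dotZr) -/(sqdist m y); ring.
Qed.

Lemma near_punctured (y : 'rV[R]_d) (P Q : 'rV[R]_d -> Prop) :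
  (\forall z \near y, P z) -> (forall z, P z -> z != y -> Q z) ->
  \forall z \near y^', Q z.
Proof.
move=> Py PQ; rewrite near_withinE; apply: filterS Py => z Pz zy; exact: PQ.
Qed.

Lemma quad_sub_subsolution gamma q c beta u :
  visc_subsolution gamma
     (fun x r p => dot (q x) p * enorm p `^ (2 - gamma) + c x * pos_part r `^ beta) u ->
  quad_sub gamma q u (fun x => c x * pos_part (u x) `^ beta).
Proof.
move=> [_ usub] y m s k s0 ym uy.
have := usub y (quartic (u y) s k 1 m y) (C2_quartic _ _ _ _ _ _ _).
rewrite /inf_lap_sub grad_quartic scaler_eq0 negb_or mulf_neq0//= subr_eq0 ym.
rewrite inf_lap_quartic// addrA [X in _ + X + _]mulrC -mulrDr; apply.
  by rewrite /quartic subrr sqdistxx expr0n/= !mulr0 !addr0.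
apply: near_punctured uy _ => z uz zy; apply: le_lt_trans uz _.
by rewrite /quartic mul1r ltrDl exprn_gt0// sqdist_gt0.
Qed.

Lemma max_quad0 : max_quad (0 : 'M[R]_d) = 0.
Proof.
rewrite /max_quad; set A := [set _ | _ in _].
(* The unit sphere is empty when [d = 0], and the supremum of the empty set is 0 by convention. *)
have [->|A0] := eqVneq A set0; first exact: sup0.
rewrite (_ : A = [set 0]) ?sup1//; apply/seteqP; split=> [_ [xi _ <-]|_ ->].
  by rewrite mulmx0 mul0mx mxE.
have [_ [xi xi1 _]] := (set0P _).1 A0.
by exists xi => //; rewrite mulmx0 mul0mx mxE.
Qed.

(** The test function [u y + (N + 1) |z - y|^4] has zero gradient and Hessian at [y], so the
    infinity Laplacian is read as 0 both for [gamma < 2] and for [gamma = 2]. *)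
Lemma zero_grad_subsolution gamma q c beta u y (N : R) :
  visc_subsolution gamma
     (fun x r p => dot (q x) p * enorm p `^ (2 - gamma) + c x * pos_part r `^ beta) u ->
  (\forall z \near y, u z <= u y + N * sqdist y z ^+ 2) ->
  0 <= c y * pos_part (u y) `^ beta.
Proof.
move=> [_ usub] uy.
have := usub y (quartic (u y) 0 0 (N + 1) y y) (C2_quartic _ _ _ _ _ _ _).
rewrite /inf_lap_sub grad_quartic mulr0 scale0r eqxx/= dot0r mul0r add0r.
rewrite (_ : hessian _ _ = 0); last first.
  by apply/matrixP => i j; rewrite hessian_quartic [RHS]mxE !mulr0 !mul0r addr0.
rewrite max_quad0 if_same add0r; apply.
  by rewrite /quartic subrr sqdistxx expr0n/= !mulr0 !addr0.
apply: near_punctured uy _ => z uz zy; apply: le_lt_trans uz _.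
rewrite /quartic !mul0r !addr0 mulrDl mul1r ltrD2l ltrDl.
by rewrite exprn_gt0// sqdist_gt0.
Qed.

(** The differential part is homogeneous of degree [3 - gamma], so scaling by [theta] produces
    [theta^(3 - gamma) c V^beta]. This is at least [c (theta V)^beta], because [c < 0], [theta <= 1]
    and [beta <= 3 - gamma]. The sign change turns touching from below into touching from above. *)
Lemma quad_sub_supersolution gamma q c beta V (theta : R) :
  (forall x, c x < 0) -> (forall x, 0 <= V x) -> beta <= 3 - gamma ->
  0 < theta <= 1 ->
  visc_supersolution gamma
     (fun x r p => dot (q x) p * enorm p `^ (2 - gamma) + c x * r `^ beta) V ->
  quad_sub gamma q (fun x => - (theta * V x)) (fun x => - (c x * (theta * V x) `^ beta)).
Proof.
move=> c0 V0 bg /andP[t0 t1] [_ Vsup] y m s k s0 ym Vy.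
set g := (2 * s) *: (y - m).
have s'0 : - (s / theta) != 0 by rewrite oppr_eq0 mulf_neq0// invr_eq0 gt_eqF.
have := Vsup y (quartic (V y) (- (s / theta)) (- (k / theta)) (-1) m y)
  (C2_quartic _ _ _ _ _ _ _).
rewrite /inf_lap_super grad_quartic scaler_eq0 negb_or mulf_neq0//= subr_eq0 ym.
rewrite inf_lap_quartic// addrA [X in _ + X + _]mulrC -mulrDr.
rewrite (_ : (2 * - (s / theta)) *: (y - m) = (- theta^-1) *: g); last first.
  by rewrite /g scalerA; congr (_ *: _); ring.
set X := _ + _ => Xle0.
suff : X <= 0.
  rewrite /X enormZ normrN gtr0_norm ?invr_gt0//.
  rewrite (@powRM _ theta^-1) ?invr_ge0 ?enorm_ge0 ?(ltW t0)//.
  rewrite (dotZr (- theta^-1)); set h := enorm g `^ _ => {}Xle0.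
  have ti : theta^-1 `^ (2 - gamma) * theta `^ (2 - gamma) = 1.
    by rewrite -powRM ?invr_ge0 ?(ltW t0)// mulVf ?gt_eqF// powR1.
  have tp : 0 < theta `^ (3 - gamma) by rewrite powR_gt0.
  have tE : theta `^ (3 - gamma) = theta * theta `^ (2 - gamma).
    rewrite (_ : 3 - gamma = 1 + (2 - gamma)); last by ring.
    by rewrite powRD ?(gt_eqF t0) ?implybT// powRr1// ltW.
  have main : theta `^ (3 - gamma) * (c y * V y `^ beta) <=
      h * (2 * s + 4 * k * sqdist m y + dot (q y) g).
    have := ler_wpM2l (ltW tp) Xle0; rewrite mulr0 => {Xle0}.
    set B := theta^-1 `^ _ in ti *.
    rewrite [X in X <= 0 -> _](_ : _ = - (B * theta `^ (2 - gamma)) * (h *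
      (2 * s + 4 * k * sqdist m y + dot (q y) g)) +
       theta `^ (3 - gamma) * (c y * V y `^ beta)); last first.
      by rewrite tE; field; rewrite gt_eqF.
    by rewrite ti; lra.
  rewrite powRM// ?(ltW t0)//.
  have : theta `^ beta * (c y * V y `^ beta) <= theta `^ (3 - gamma) * (c y * V y `^ beta).
    rewrite ler_wnM2r//; first by rewrite nmulr_rle0// powR_ge0.
    by apply: ger_powR => //; rewrite t0.
  by rewrite mulrCA in main *; lra.
apply: Xle0.
  by rewrite /quartic subrr sqdistxx expr0n/= !mulr0 !addr0.
apply: near_punctured Vy _ => z Vz zy.
have D0 : 0 < sqdist y z ^+ 2 by rewrite exprn_gt0// sqdist_gt0.
rewrite /quartic -(ltr_pM2l t0); set D := sqdist m z - _ in Vz *.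
rewrite (_ : theta * (_ + _) = theta * V y - s * D - k / 2 * D ^+ 2
  - theta * sqdist y z ^+ 2); last by field; rewrite gt_eqF.
have := mulr_gt0 t0 D0; lra.
Qed.

End QuadSub.

(** * Convexity along spheres *)

Section Continuity.
Context {R : realType} {d : nat}.
Context {T : Type} {F : set_system T} {FF : Filter F}.

Lemma cvg_powR (f : T -> R) (a r : R) : 0 < a ->
  f @ F --> a -> f t `^ r @[t --> F] --> a `^ r.
Proof.
move=> a0 fa; have E (b : R) : 0 < b -> b `^ r = expR (r * ln b).
  by move=> b0; rewrite /powR gt_eqF.
have /cvgr_gt/(_ _ a0) fpos := fa.
rewrite E//; apply: (@cvg_trans _ ((fun t => expR (r * ln (f t))) @ F)).
  by apply: near_eq_cvg; apply: filterS fpos => t ft; rewrite E.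
have lnf : ln (f t) @[t --> F] --> ln a := cvg_comp _ _ fa (continuous_ln a0).
exact: (cvg_comp _ _ (cvgM (cvg_cst r) lnf) (@continuous_expR R (r * ln a))).
Qed.

Lemma cvg_enorm (f : T -> 'rV[R]_d) (x : 'rV[R]_d) :
  f @ F --> x -> enorm (f t) @[t --> F] --> enorm x.
Proof.
move=> fx; have D : dot (f t) (f t) @[t --> F] --> dot x x.
  exact: cvg_dot.
exact: (cvg_comp _ _ D (@sqrt_continuous R (dot x x))).
Qed.

(** Joint continuity of the tested expression in the contact point and the slope, at a nonzero
    gradient, where the power is continuous. *)
Lemma cvg_eikonal (gamma k K : R) (q : 'rV[R]_d -> 'rV[R]_d) m
    (y : T -> 'rV[R]_d) (s : T -> R) (y0 : 'rV[R]_d) (s0 : R) :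
  continuous q -> y @ F --> y0 -> s @ F --> s0 -> s0 != 0 -> y0 != m ->
  enorm ((2 * s t) *: (y t - m)) `^ (2 - gamma) *
     (2 * s t + 4 * k * sqdist m (y t) + dot (q (y t)) ((2 * s t) *: (y t - m))) + K
   @[t --> F] -->
  enorm ((2 * s0) *: (y0 - m)) `^ (2 - gamma) *
     (2 * s0 + 4 * k * sqdist m y0 + dot (q y0) ((2 * s0) *: (y0 - m))) + K.
Proof.
move=> cq yy0 ss0 s00 y0m.
have C (a : R) : a @[_ --> F] --> a := @cvg_cst R a T F FF.
have s2 : 2 * s t @[t --> F] --> 2 * s0 by exact: (cvgM (C 2) ss0).
have ym : y t - m @[t --> F] --> y0 - m by exact: (cvgB yy0 (cvg_cst m)).
have g : (2 * s t) *: (y t - m) @[t --> F] --> (2 * s0) *: (y0 - m).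
  exact: (cvgZ s2 ym).
have qy : q (y t) @[t --> F] --> q y0 := cvg_comp _ _ yy0 (cq y0).
have g0 : 0 < enorm ((2 * s0) *: (y0 - m)).
  by rewrite enorm_gt0 scaler_eq0 negb_or mulf_neq0//= subr_eq0.
have h := @cvg_powR _ _ (2 - gamma) g0 (@cvg_enorm _ _ g).
have Tm : sqdist m (y t) @[t --> F] --> sqdist m y0 by exact: cvg_sqdist.
exact: (cvgD (cvgM h (cvgD (cvgD s2 (cvgM (C (4 * k)) Tm)) (cvg_dot _ _ _ _ qy g))) (C K)).
Qed.

End Continuity.

(** * Stability of failed touching, and maxima over spheres *)

Section NoTouching.
Context {R : realType} {d : nat}.
Implicit Types (x y z m v w g : 'rV[R]_d) (f C : 'rV[R]_d -> R).

(** A strict failure of the tested inequality at the point [x] with slope [s] persists, by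
    continuity, for nearby points and slopes. *)
Lemma no_touching_near gamma q f C x m (s k K : R) :
  continuous q -> quad_sub gamma q f C -> s != 0 -> x != m ->
  (\forall y \near x, C y <= K) ->
  enorm ((2 * s) *: (x - m)) `^ (2 - gamma) *
    (2 * s + 4 * k * sqdist m x + dot (q x) ((2 * s) *: (x - m))) + K < 0 ->
  exists2 r, 0 < r & forall y t, sqdist x y < r -> `|t - s| < r ->
    ~ \forall z \near y, f z <= f y + t * (sqdist m z - sqdist m y)
                                + k / 2 * (sqdist m z - sqdist m y) ^+ 2.
Proof.
move=> cq fsub s0 xm CK lt0.
pose F := filter_prod (nbhs x) (nbhs s).
have FF : Filter F by exact: filter_prod_filter.
have c1 : fst @ F --> x by exact: cvg_fst.
have c2 : snd @ F --> s by exact: cvg_snd.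
have := @cvg_eikonal R d _ F FF gamma k K q m fst snd x s cq c1 c2 s0 xm.
move=> /cvgr_lt/(_ _ lt0) nE.
have nC : \forall p \near F, C p.1 <= K by exact: (c1 _ CK).
have nm : \forall p \near F, p.1 != m.
  have mx : 0 < sqdist m x by rewrite sqdist_gt0.
  apply: (c1 [set z | z != m]).
  have mz : \forall z \near x, 0 < sqdist m z.
    exact: (cvgr_gt _ (@sqdist_continuous R d m x)).
  by apply: filterS mz => z; rewrite sqdist_gt0.
have ns : \forall p \near F, p.2 != 0 by exact: (cvgr_neq0 _ c2).
have [[A B] /= [Ax Bs] AB] := filterI (filterI nE nC) (filterI nm ns).
have [r1 r10 r1A] := near_sqdist _ _ Ax.
have /nbhs_ballP[r2 /= r20 r2B] := Bs.
exists (Num.min r1 r2); first by rewrite lt_min r10.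
move=> y t; rewrite !lt_min => /andP[yr _] /andP[_ tr] fy.
have [] := AB (y, t) _; first by split; [exact: r1A|apply: r2B; rewrite /ball/= distrC].
move=> /= [E CyK] [ym t0].
have := fsub y m t k t0 ym fy; lra.
Qed.

Lemma near0_mul_lt (c e : R) : 0 < e -> \forall t \near 0^'+, c * t < e.
Proof.
move=> e0; have c1 : 0 < `|c| + 1 by rewrite ltr_wpDl.
near=> t.
have t0 : 0 < t by near: t; exact: nbhs_right_gt.
have : t < e / (`|c| + 1) by near: t; apply: nbhs_right_lt; rewrite divr_gt0.
rewrite ltr_pdivlMr// => te; apply: le_lt_trans te.
by rewrite mulrC ler_pM2l// (le_trans (ler_norm _))// lerDl.
Unshelve. all: by end_near. Qed.

Lemma continuous_sub_quartic f A s k l m y : continuous f ->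
  continuous (fun z => f z - quartic A s k l m y z).
Proof.
move=> cf z; exact: (cvgB (cf z) (@quartic_continuous R d A s k l m y z)).
Qed.

Lemma sphere_neq0 m x (b : R) : x != m -> 0 <= b -> exists z, sqdist m z = b.
Proof.
move=> xm b0; have mx : 0 < sqdist m x by rewrite sqdist_gt0.
exists (m + Num.sqrt (b / sqdist m x) *: (x - m)).
rewrite {1}/sqdist [_ + _ - _]addrC addKr dotZl dotZr mulrA -expr2.
rewrite sqr_sqrtr; last by rewrite divr_ge0// ltW.
by apply: divfK; rewrite gt_eqF.
Qed.

Lemma sphere_max f m x (b : R) : continuous f -> x != m -> 0 <= b ->
  exists2 z, sqdist m z = b & forall w, sqdist m w = b -> f w <= f z.
Proof.
move=> cf xm b0; have [z0 z0b] := sphere_neq0 _ _ _ xm b0.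
have [||z [/= z1 z2] zm] := continuous_max_on f
    ([set z | b <= sqdist m z] `&` [set z | sqdist m z <= b]) _ _ cf.
- by exists z0; rewrite /= z0b.
- rewrite setIC; apply: compact_closedI; first exact: compact_sqdist_le.
  exact: closed_sqdist_ge.
- exists z; first by apply/eqP; rewrite eq_le z1 z2.
  by move=> w wb; apply: zm; rewrite /= wb.
Qed.

End NoTouching.

(** * Real inequalities behind the convexity along spheres *)

Section RidgeArith.
Context {R : realFieldType}.

(** Excludes contact points [y] far from [x]: [a = |x - m|^2], [a + T = |y - m|^2], [D = |x - y|^2]
    and [X = |2m - x - y|^2]. If [D >= r], then [X] is below [4a] by at least [r / 2], and the
    resulting loss [2 N a r] outweighs the polynomial, which is of order [t]. *)
Lemma ridge_far (N a r s k e t T D X : R) : 0 < N -> 0 < a -> 0 < r -> 0 < t <= 1 ->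
  4 * t < r -> (`|s| + r + `|k|) * t < 2 * N * a * r -> `|e - s| < r / 2 ->
  `|T| < t -> r <= D -> 0 <= X -> X = 4 * a + 2 * T - D ->
  N * (X ^+ 2 - (4 * a) ^+ 2) < e * T + k / 2 * T ^+ 2.
Proof.
move=> N0 a0 r0 /andP[t0 t1] tr tB es Tt rD X0 XE.
have T1 : T < t by exact: le_lt_trans (ler_norm _) Tt.
have XY : X <= 4 * a - r / 2 by lra.
have X1 : X ^+ 2 <= 4 * a * (4 * a - r / 2).
  by rewrite expr2; apply: ler_pM => //; lra.
have N1 : N * (X ^+ 2 - (4 * a) ^+ 2) <= - (2 * N * a * r).
  rewrite [leRHS](_ : _ = N * (4 * a * (4 * a - r / 2) - (4 * a) ^+ 2)); last by field.
  by rewrite ler_pM2l// lerD2r.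
have e1 : `|e| <= `|s| + r.
  by rewrite -(subrK s e) (le_trans (ler_normD _ _))//; lra.
have eT : `|e * T| <= (`|s| + r) * t by rewrite normrM ler_pM// ltW.
have kT : `|k * T ^+ 2| <= `|k| * t.
  rewrite normrM ler_wpM2l// normrX (le_trans _ (ltW Tt))// expr2.
  by rewrite ler_piMr ?(le_trans (ltW Tt)).
move: eT kT; rewrite !ler_norml => /andP[eT _] /andP[kT _].
have kt0 := mulr_ge0 (normr_ge0 k) (ltW t0).
have -> : k / 2 * T ^+ 2 = (k * T ^+ 2) / 2 by field.
lra.
Qed.

(** [F], [P] and [Q] stand for [f x] and for the maxima over the outer and the inner sphere. The
    slope [(P - Q) / (2t)] makes both entries of the maximum equal to [(P + Q) / 2 - k t^2 / 2]; the
    work is to show that this slope is close to [s]. *)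
Lemma ridge_slope (F P Q N r s k t : R) : 0 < t -> 0 < r ->
  (4 * N + `|k|) * t < r / 4 ->
  P <= F + s * t + 4 * N * t ^+ 2 -> Q <= F - s * t + 4 * N * t ^+ 2 ->
  (forall e, `|e - s| < r / 2 ->
    F <= Num.max (P - e * t - k / 2 * t ^+ 2) (Q + e * t - k / 2 * t ^+ 2)) ->
  2 * F + k * t ^+ 2 <= P + Q.
Proof.
move=> t0 r0 tN P1 Q1 sep.
have dt : (4 * N + `|k|) * t * t < r / 4 * t by rewrite ltr_pM2r.
have {}dt : 4 * N * t ^+ 2 + `|k| * t ^+ 2 < r / 4 * t.
  by rewrite (_ : _ + _ = (4 * N + `|k|) * t * t)//; ring.
have : `|k * t ^+ 2| <= `|k| * t ^+ 2 by rewrite normrM (ger0_norm (sqr_ge0 t)).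
rewrite ler_norml => /andP[k21 k22].
have kE : k / 2 * t ^+ 2 = (k * t ^+ 2) / 2 by field.
have kt0 := mulr_ge0 (normr_ge0 k) (sqr_ge0 t).
(* With slope [s - r / 4] the entry in [Q] is less than [F], so the entry in [P] must exceed it;
   slope [s + r / 4] exchanges the roles. *)
have fz : F <= P - (s - r / 4) * t - k / 2 * t ^+ 2.
  have : `|s - r / 4 - s| < r / 2.
    by rewrite (_ : s - r / 4 - s = - (r / 4)) ?normrN ?gtr0_norm; lra.
  by move=> /sep; rewrite le_max => /orP[//|]; lra.
have fw : F <= Q + (s + r / 4) * t - k / 2 * t ^+ 2.
  have : `|s + r / 4 - s| < r / 2.
    by rewrite (_ : s + r / 4 - s = r / 4) ?gtr0_norm; lra.
  by move=> /sep; rewrite le_max => /orP[|//]; lra.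
have : `|(P - Q) / (2 * t) - s| < r / 2.
  rewrite (_ : _ - s = (P - Q - 2 * s * t) / (2 * t)); last first.
    by field; rewrite gt_eqF.
  rewrite normrM normfV (@gtr0_norm _ (2 * t)) ?mulr_gt0// ltr_pdivrMr ?mulr_gt0//.
  by rewrite ltr_norml; apply/andP; split; lra.
move=> /sep.
rewrite (_ : (P - Q) / (2 * t) * t = (P - Q) / 2); last first.
  by field; rewrite gt_eqF.
by rewrite le_max => /orP[] H; lra.
Qed.

End RidgeArith.

(** * Second differences of the maxima over spheres *)

Section Ridge.
Context {R : realType} {d : nat}.
Implicit Types (x y z m v w g : 'rV[R]_d) (f C : 'rV[R]_d -> R).

(* By the parallelogram law, the first square is |z - y|^4 for y = 2m - x, and the
   second one is |x - y|^4. *)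
Definition ridge_bound f x m (N : R) :=
  forall z, sqdist m z <= 2 * sqdist m x -> f z <= f x +
     N * ((2 * sqdist m z + 2 * sqdist m x - sqdist x z) ^+ 2
          - (4 * sqdist m x) ^+ 2).

(** If [A < f x], then [f] minus the polynomial has its maximum over the annulus at an interior
    point. By [ridge_bound] this point is close to [x], where touching is excluded. *)
Lemma annulus_sep f x m (N s k r t e A : R) :
  0 < N -> x != m -> continuous f -> ridge_bound f x m N -> 0 < r ->
  (forall y s', sqdist x y < r -> `|s' - s| < r ->
    ~ \forall z \near y, f z <= f y + s' * (sqdist m z - sqdist m y)
                                + k / 2 * (sqdist m z - sqdist m y) ^+ 2) ->
  0 < t < 1 -> t < sqdist m x -> `|k| * t < r / 2 -> 4 * t < r ->
  (`|s| + r + `|k|) * t < 2 * N * sqdist m x * r -> `|e - s| < r / 2 ->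
  (forall z, sqdist m z = sqdist m x + t -> f z <= A + e * t + k / 2 * t ^+ 2) ->
  (forall z, sqdist m z = sqdist m x - t -> f z <= A - e * t + k / 2 * t ^+ 2) ->
  f x <= A.
Proof.
move=> N0 xm cf fN r0 notouch /andP[t0 t1] ta tk tr tB es out inn.
have a0 : 0 < sqdist m x by rewrite sqdist_gt0.
rewrite leNgt; apply/negP => Afx; rewrite /ridge_bound in fN.
pose g z := f z - quartic 0 e k 0 m x z.
have gE z : g z = f z - e * (sqdist m z - sqdist m x)
    - k / 2 * (sqdist m z - sqdist m x) ^+ 2.
  by rewrite /g /quartic; ring.
have xin : sqdist m x - t <= sqdist m x <= sqdist m x + t.
  by rewrite gerBl lerDl ltW.
have [||y [/= y1 y2] ymax] := continuous_max_on g
    ([set z | sqdist m x - t <= sqdist m z] `&`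
     [set z | sqdist m z <= sqdist m x + t]) _ _
    (continuous_sub_quartic _ _ _ _ _ _ _ cf).
- by exists x; apply/andP.
- rewrite setIC; apply: compact_closedI; first exact: compact_sqdist_le.
  exact: closed_sqdist_ge.
have gx : f x <= g y.
  have -> : f x = g x by rewrite gE subrr; ring.
  by apply: ymax; apply/andP.
have {}y1 : sqdist m x - t < sqdist m y.
  rewrite lt_neqAle y1 andbT; apply/eqP => ya.
  have := inn _ (esym ya); move: gx; rewrite gE -ya.
  by clear - Afx; lra.
have {}y2 : sqdist m y < sqdist m x + t.
  rewrite lt_neqAle y2 andbT; apply/eqP => ya.
  have := out _ ya; move: gx; rewrite gE ya.
  by clear - Afx; lra.
pose T := sqdist m y - sqdist m x.
have Tt : `|T| < t by rewrite ltr_norml /T; clear - y1 y2; lra.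
have Tr : sqdist m y = sqdist m x + T by rewrite /T addrC subrK.
(* Recentred at [y], the polynomial has slope [e + k T], still within [r] of [s]. *)
apply: (notouch y (e + k * T)).
- rewrite ltNge; apply/negP => ry.
  have Xm : 2 * sqdist m y + 2 * sqdist m x - sqdist x y = sqdist (2 *: m - x) y.
    by rewrite (sqdist_parallelogram m x y); ring.
  have fy : f y <= f x + N * (sqdist (2 *: m - x) y ^+ 2 - (4 * sqdist m x) ^+ 2).
    rewrite -Xm; apply: fN; apply: (le_trans (ltW y2)).
    by rewrite mulrDl mul1r lerD2l ltW.
  have t01 : 0 < t <= 1 by rewrite t0 ltW.
  have XE : sqdist (2 *: m - x) y = 4 * sqdist m x + 2 * T - sqdist x y.
    by rewrite -Xm Tr; ring.
  have := ridge_far _ _ _ _ k _ _ _ _ _ N0 a0 r0 t01 tr tB es Tt ry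
    (sqdist_ge0 _ _) XE.
  move: gx; rewrite gE -/T => gx far; clear - gx far fy; lra.
- have : `|k * T| < r / 2.
    by rewrite normrM; apply: le_lt_trans tk; rewrite ler_wpM2l// ltW.
  have -> : e + k * T - s = (e - s) + k * T by ring.
  by move=> kT; rewrite (le_lt_trans (ler_normD _ _))//; clear - kT es; lra.
- have n1 : \forall z \near y, sqdist m x - t < sqdist m z.
    exact: (cvgr_gt _ (@sqdist_continuous R d m y)).
  have n2 : \forall z \near y, sqdist m z < sqdist m x + t.
    exact: (cvgr_lt _ (@sqdist_continuous R d m y)).
  apply: filterS (filterI n1 n2) => z [z1 z2].
  have : g z <= g y by apply: ymax; split; exact: ltW.
  by rewrite !gE -/T /T; clear; lra.
Qed.

(* The k-convexity at x of the maximum of f over the spheres around m, as a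
   function of |z - m|^2: the test polynomial interpolating this maximum at the
   two outer spheres has slope close to s, so it cannot touch f in between. *)
Lemma ridge_convexity gamma q f C x m (N k K : R) :
  0 < N -> x != m -> continuous q -> continuous f -> quad_sub gamma q f C ->
  ridge_bound f x m N ->
  (\forall y \near x, C y <= K) ->
  let s := 16 * N * sqdist m x in
  enorm ((2 * s) *: (x - m)) `^ (2 - gamma) *
    (2 * s + 4 * k * sqdist m x + dot (q x) ((2 * s) *: (x - m))) + K < 0 ->
  \forall t \near 0^'+, exists z w,
    [/\ sqdist m z = sqdist m x + t, sqdist m w = sqdist m x - t &
        2 * f x + k * t ^+ 2 <= f z + f w].
Proof.
move=> N0 xm cq cf fsub fN CK s lt0.
have a0 : 0 < sqdist m x by rewrite sqdist_gt0.
have s0 : 0 < s by rewrite !mulr_gt0.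
have [r r0 notouch] := no_touching_near _ _ _ _ _ _ _ _ _ cq fsub
  (lt0r_neq0 s0) xm CK lt0.
near=> t.
have t0 : 0 < t by near: t; exact: nbhs_right_gt.
have t01 : 0 < t < 1 by rewrite t0/=; near: t; exact: nbhs_right_lt.
have ta : t < sqdist m x by near: t; exact: nbhs_right_lt.
have tk : `|k| * t < r / 2 by near: t; apply: near0_mul_lt; rewrite divr_gt0.
have tr : 4 * t < r by near: t; exact: near0_mul_lt.
have tB : (`|s| + r + `|k|) * t < 2 * N * sqdist m x * r.
  by near: t; apply: near0_mul_lt; rewrite !mulr_gt0.
have tN : (4 * N + `|k|) * t < r / 4.
  by near: t; apply: near0_mul_lt; rewrite divr_gt0.
have sep (e A : R) := @annulus_sep f x m N s k r t e A N0 xm cf fN r0 notouch t01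
  ta tk tr tB.
(* Dropping [sqdist x z] from the bound leaves [N ((4a + 2T)^2 - (4a)^2) = s T + 4 N T^2], with
   [a = |x - m|^2] and [T = |z - m|^2 - a]; hence the value of [s]. *)
have up z : sqdist m z <= 2 * sqdist m x -> f z <= f x
    + s * (sqdist m z - sqdist m x) + 4 * N * (sqdist m z - sqdist m x) ^+ 2.
  move=> /fN fz; apply: le_trans fz _; rewrite -[leRHS]addrA lerD2l.
  rewrite [leRHS](_ : _ = N * ((2 * sqdist m z + 2 * sqdist m x) ^+ 2
    - (4 * sqdist m x) ^+ 2)); last by rewrite /s; ring.
  rewrite ler_pM2l// lerD2r.
  have X0 : 0 <= 2 * sqdist m z + 2 * sqdist m x - sqdist x z.
    rewrite (_ : _ - _ = sqdist (2 *: m - x) z) ?sqdist_ge0//.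
    by rewrite (sqdist_parallelogram m x z); ring.
  rewrite lerXn2r ?nnegrE// ?gerBl ?sqdist_ge0//.
  by rewrite addr_ge0// mulr_ge0// sqdist_ge0.
have [z za zm] := sphere_max f m x (sqdist m x + t) cf xm (ltW (addr_gt0 a0 t0)).
have at0 : 0 <= sqdist m x - t by rewrite subr_ge0 ltW.
have [w wa wm] := sphere_max f m x (sqdist m x - t) cf xm at0.
exists z, w; split=> //.
have za2 : sqdist m z <= 2 * sqdist m x by rewrite za mulrDl mul1r lerD2l ltW.
have wa2 : sqdist m w <= 2 * sqdist m x.
  by rewrite wa mulrDl mul1r lerD2l (@le_trans _ _ 0) ?oppr_le0 ?ltW.
have := up z za2; have := up w wa2; rewrite za wa.
rewrite (_ : sqdist m x + t - sqdist m x = t); last by ring.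
rewrite (_ : sqdist m x - t - sqdist m x = - t); last by ring.
rewrite sqrrN mulrN => up2 up1.
apply: (ridge_slope _ _ _ N r s k t) => // e es.
set M := Num.max _ _; apply: (sep e M es) => v.
- move=> /zm vz; have : f z - e * t - k / 2 * t ^+ 2 <= M by rewrite le_max lexx.
  clear - vz; lra.
- move=> /wm vw.
  have : f w + e * t - k / 2 * t ^+ 2 <= M by rewrite le_max lexx orbT.
  clear - vw; lra.
Unshelve. all: by end_near. Qed.

End Ridge.

(** * Comparison *)

Section Doubling.
Context {R : realType} {d : nat}.
Implicit Types (x y z m v w g : 'rV[R]_d) (f C : 'rV[R]_d -> R).

(** If the sum [Q] is negative, there are [k1] and [k2] for which both tested inequalities fail and
    whose sum exceeds [- 16 N]. The two convexity estimates then contradict the doubled maximum at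
    order [t^2]. *)
Lemma doubling_max gamma q f1 C1 f2 C2 x y (N K1 K2 : R) :
  let m := 2^-1 *: (x + y) in let g := (4 * N * sqdist x y) *: (x - y) in
  0 < N -> x != y -> continuous q -> continuous f1 -> continuous f2 ->
  quad_sub gamma q f1 C1 -> quad_sub gamma q f2 C2 ->
  (forall z w, sqdist m z <= 2 * sqdist m x -> sqdist m w <= 2 * sqdist m x ->
     f1 z + f2 w - N * sqdist z w ^+ 2 <= f1 x + f2 y - N * sqdist x y ^+ 2) ->
  (\forall z \near x, C1 z <= K1) -> (\forall z \near y, C2 z <= K2) ->
  0 <= enorm g `^ (2 - gamma) * dot (q x - q y) g + K1 + K2.
Proof.
move=> m g N0 xy cq cf1 cf2 sub1 sub2 fmax CK1 CK2.
have mE : 2 *: m = x + y by rewrite /m scalerA divff ?scale1r// pnatr_eq0.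
have xE : 2 *: m - x = y by rewrite mE addrAC subrr add0r.
have yE : 2 *: m - y = x by rewrite mE addrK.
have mx : sqdist m x = sqdist x y / 4 by exact: sqdist_midpoint.
have my : sqdist m y = sqdist m x.
  by rewrite /m addrC sqdist_midpoint sqdistC addrC sqdist_midpoint.
clearbody m.
have a0 : 0 < sqdist m x by rewrite mx divr_gt0// sqdistC sqdist_gt0.
have xyE : sqdist x y = 4 * sqdist m x by rewrite mx; field.
set a := sqdist m x in a0 mx my xyE fmax *.
have xm : x != m by rewrite -sqdist_gt0.
have ym : y != m by rewrite -sqdist_gt0 my.
have in_x : a <= 2 * a by rewrite ler_peMl ?ltW//; lra.
have b1 : ridge_bound f1 x m N.
  move=> z za; have := fmax z y za; rewrite my => /(_ in_x).
  rewrite (_ : 2 * _ + _ - _ = sqdist z y); last first.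
    by rewrite [RHS]sqdistC -[in RHS]xE (sqdist_parallelogram m x z) -/a; ring.
  by rewrite -/a -xyE; clear; lra.
have b2 : ridge_bound f2 y m N.
  move=> z; rewrite my => za; have := fmax x z in_x za.
  rewrite (_ : 2 * _ + _ - _ = sqdist x z); last first.
    by rewrite -[in RHS]yE (sqdist_parallelogram m y z) my; ring.
  by rewrite -xyE; clear; lra.
pose s := 16 * N * a.
have gx : (2 * s) *: (x - m) = g.
  rewrite /g xyE (_ : x - m = 2^-1 *: (x - y)); last first.
    apply: (@scalerI _ _ (2 : R)); first by rewrite pnatr_eq0.
    rewrite scalerBr mE scalerA divff ?pnatr_eq0// scale1r.
    by rewrite scaler_nat mulr2n opprD addrACA subrr add0r.
  by rewrite scalerA; congr (_ *: _); rewrite /s; field.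
have gy : (2 * s) *: (y - m) = - g.
  rewrite -gx -[RHS]scalerN; congr (_ *: _); rewrite opprB.
  by apply/eqP; rewrite subr_eq addrAC -mulr2n -scaler_nat mE addrAC subrr add0r.
have g0 : 0 < enorm g.
  rewrite enorm_gt0 -gx scaler_eq0 negb_or subr_eq0 xm andbT.
  by rewrite mulf_neq0// gt_eqF// !mulr_gt0.
have h0 : 0 < enorm g `^ (2 - gamma) by exact: powR_gt0.
set h := enorm g `^ (2 - gamma) in h0 *.
rewrite leNgt; apply/negP => Q0; set Q := _ + K2 in Q0.
(* Since [Q = - 4 h e], each tested expression can be made equal to [- h e]; the remaining [2 h e]
   is the excess [e / (2a)] of [k1 + k2] over [- 16 N]. *)
pose e := - Q / (4 * h).
have e0 : 0 < e by rewrite divr_gt0 ?oppr_gt0// mulr_gt0.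
pose k1 := (- K1 / h - e - 2 * s - dot (q x) g) / (4 * a).
pose k2 := (- K2 / h - e - 2 * s + dot (q y) g) / (4 * a).
have h00 : h != 0 by rewrite gt_eqF.
have a00 : a != 0 by rewrite gt_eqF.
have E1 : h * (2 * s + 4 * k1 * a + dot (q x) g) + K1 < 0.
  rewrite (_ : _ + _ = - (h * e)) ?oppr_lt0 ?(mulr_gt0 h0 e0)//.
  by rewrite /k1; field; rewrite ?a00 ?h00.
have E2 : h * (2 * s + 4 * k2 * a + dot (q y) (- g)) + K2 < 0.
  rewrite (_ : _ + _ = - (h * e)) ?oppr_lt0 ?(mulr_gt0 h0 e0)//.
  by rewrite /k2 dotNr; field; rewrite ?a00 ?h00.
have ksum : k1 + k2 = - (16 * N) + e / (2 * a).
  have QE : K1 + K2 + h * (dot (q x) g - dot (q y) g) = - (4 * h * e).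
    rewrite /e (_ : 4 * h * _ = - Q); last by field; rewrite ?a00 ?h00.
    by rewrite opprK /Q dotDl dotNl; ring.
  rewrite /k1 /k2 /s; have -> : K2 = - (4 * h * e) - K1 - h * (dot (q x) g - dot (q y) g).
    by rewrite -QE; ring.
  by field; rewrite ?a00 ?h00.
have r1 := @ridge_convexity R d gamma q f1 C1 x m N k1 K1 N0 xm cq cf1 sub1 b1 CK1.
rewrite /= -/a -/s gx in r1; have {}r1 := r1 E1.
have r2 := @ridge_convexity R d gamma q f2 C2 y m N k2 K2 N0 ym cq cf2 sub2 b2 CK2.
rewrite /= my -/s gy {1}/enorm dotNl dotNr opprK -/(enorm g) in r2; have {}r2 := r2 E2.
suff : \forall t \near (0:R)^'+, False by case/filter_ex.
near=> t.
have t0 : 0 < t by near: t; exact: nbhs_right_gt.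
have t1 : t < 1 by near: t; exact: nbhs_right_lt.
have ta : t < a by near: t; exact: nbhs_right_lt.
have te : 2 * N / a ^+ 2 * t < e / (2 * a).
  by near: t; apply: near0_mul_lt; rewrite divr_gt0// mulr_gt0.
have [z1 [w1 [z1a w1a f1t]]] : exists z w,
    [/\ sqdist m z = a + t, sqdist m w = a - t &
        2 * f1 x + k1 * t ^+ 2 <= f1 z + f1 w] by near: t; exact: r1.
have [z2 [w2 [z2a w2a f2t]]] : exists z w,
    [/\ sqdist m z = a + t, sqdist m w = a - t &
        2 * f2 y + k2 * t ^+ 2 <= f2 z + f2 w] by near: t; exact: r2.
have le2 b : b = a + t \/ b = a - t -> b <= 2 * a by clear - ta t0; lra.
have sq z w : sqdist z w <= 4 * a - t ^+ 2 / a ->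
    sqdist z w ^+ 2 <= (4 * a - t ^+ 2 / a) ^+ 2.
  move=> zw; rewrite lerXn2r ?nnegrE ?sqdist_ge0//.
  by rewrite (le_trans (sqdist_ge0 z w)).
(* Points of opposite spheres are paired. Each squared distance is at most [4a - t^2 / a], so each
   penalty drops by [8 N t^2] up to order [t^4]. *)
have p1 := sq _ _ (sqdist_opposite _ _ _ _ _ a0 z1a w2a).
have z2a' : sqdist m z2 = a - (- t) by rewrite opprK.
have p2 := sq w1 z2; rewrite -(sqrrN t) in p2.
have {}p2 := p2 (sqdist_opposite _ _ _ _ _ a0 w1a z2a').
have q1 := fmax z1 w2; rewrite z1a w2a in q1.
have {}q1 := q1 (le2 _ (or_introl erefl)) (le2 _ (or_intror erefl)).
have q2 := fmax w1 z2; rewrite w1a z2a in q2.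
have {}q2 := q2 (le2 _ (or_intror erefl)) (le2 _ (or_introl erefl)).
rewrite sqrrN in p2; rewrite xyE in q1 q2.
have {}p1 := ler_wpM2l (ltW N0) p1.
have {}p2 := ler_wpM2l (ltW N0) p2.
have expand : N * (4 * a - t ^+ 2 / a) ^+ 2 =
    N * (4 * a) ^+ 2 - 8 * N * t ^+ 2 + N / a ^+ 2 * t ^+ 4 by field.
rewrite expand in p1 p2.
have kt : (k1 + k2) * t ^+ 2 <= - (16 * N) * t ^+ 2 + 2 * N / a ^+ 2 * t ^+ 4.
  by clear - p1 p2 q1 q2 f1t f2t; lra.
have t20 : 0 < t ^+ 2 by rewrite exprn_gt0.
have {}te : 2 * N / a ^+ 2 * t * t ^+ 2 < e / (2 * a) * t ^+ 2 by rewrite ltr_pM2r.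
have N00 : 0 <= 2 * N / a ^+ 2 by rewrite divr_ge0 ?mulr_ge0 ?exprn_ge0 ?ltW.
have tt : t ^+ 4 <= t * t ^+ 2.
  by rewrite (_ : t ^+ 4 = t ^+ 2 * t ^+ 2) ?ler_pM2r// -?exprD// expr2 ler_piMr ?ltW.
have {}tt := ler_wpM2l N00 tt; rewrite mulrA in tt.
move: kt; rewrite ksum mulrDl; clear - te tt; lra.
Unshelve. all: by end_near. Qed.

End Doubling.

(** * Uniformity near the diagonal, and limits at infinity *)

Section Diagonal.
Context {R : realType} {d : nat}.
Implicit Types (x y z m v w g : 'rV[R]_d) (f C : 'rV[R]_d -> R).

(** Compactness makes the local thresholds uniform. The number [e] is both the distance bound and a
    parameter of [Q], so that it can also serve as an inverse Lipschitz constant. *)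
Lemma diagonal_uniform (K : set 'rV[R]_d) (Q : R -> 'rV[R]_d -> 'rV[R]_d -> Prop) :
  compact K ->
  (forall z, K z -> exists2 e0, 0 < e0 & forall e x y, 0 < e < e0 ->
     sqdist z x < e0 -> sqdist z y < e0 -> Q e x y) ->
  \forall e \near 0^'+, forall x y, K x -> sqdist x y < e -> Q e x y.
Proof.
move=> cK KQ.
pose P (e : R) x := forall y, sqdist x y < e -> Q e x y.
suff : \forall e \near 0^'+, K `<=` P e.
  by apply: filterS => e KP x y Kx; exact: KP.
apply: (iffLR (compact_near_coveringP K) cK R (0^'+) P) => z Kz.
have [e0 e00 zQ] := KQ z Kz.
(* The quarter absorbs the two factors 2 in [sqdistD]. *)
have e04 : 0 < e0 / 4 by rewrite divr_gt0.
exists ([set x | sqdist z x < e0 / 4], [set e | 0 < e < e0 / 4]) => /=.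
  split; first exact: sqdist_near.
  near=> e; apply/andP; split; near: e; first exact: nbhs_right_gt.
  exact: nbhs_right_lt.
move=> [x e] /= [zx /andP[e1 e2]] y xy; apply: zQ.
- by rewrite e1 (lt_trans e2)// ltr_pdivrMr// ltr_pMr// ltr1n.
- by rewrite (lt_trans zx)// ltr_pdivrMr// ltr_pMr// ltr1n.
- by have := sqdistD x z y; rewrite (sqdistC x z); clear - zx xy e2; lra.
Unshelve. all: by end_near. Qed.

Lemma diagonal_uniform_near (K : set 'rV[R]_d) (Q : 'rV[R]_d -> 'rV[R]_d -> Prop) :
  compact K -> (forall z, K z -> \forall p \near (z, z), Q p.1 p.2) ->
  \forall e \near (0 : R)^'+, forall x y, K x -> sqdist x y < e -> Q x y.
Proof.
move=> cK KQ; apply: (diagonal_uniform K (fun=> Q)) => // z /KQ[[A B] /= [Az Bz] AB].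
have [a a0 aA] := near_sqdist _ _ Az; have [b b0 bB] := near_sqdist _ _ Bz.
exists (Num.min a b); first by rewrite lt_min a0.
move=> _ x y _; rewrite !lt_min => /andP[xa _] /andP[_ yb].
by apply: (AB (x, y)); split; [exact: aA|exact: bB].
Qed.

Lemma normr_le_enorm x : `|x| <= enorm x.
Proof.
rewrite [leLHS]/Num.Def.normr/= mx_normrE (bigmax_le _ (enorm_ge0 x))//= => -[i j] _ /=.
rewrite ord1 -ler_sqr ?nnegrE ?enorm_ge0// sqr_enorm real_normK ?num_real//.
exact: coord_sqr_le.
Qed.

Lemma lipschitz_near_diagonal (V : 'rV[R]_d -> R) :
  [locally [lipschitz V x | x in [set: 'rV[R]_d]]] -> forall z,
  exists2 L, 0 < L & \forall p \near (z, z), `|V p.1 - V p.2| <= L * enorm (p.1 - p.2).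
Proof.
move=> lip z; have [M [_ ML]] := lip (z, z) (conj I I).
exists (`|M| + 1); first by rewrite ltr_wpDl.
have /ML : M < `|M| + 1 by rewrite (le_lt_trans (ler_norm M))// ltrDl.
move=> nH; apply: (@filterS _ (nbhs (z, z)) (nbhs_filter (z, z)) _ _ _ nH).
move=> [a b] /(_ (conj I I)) /= H.
by apply: (le_trans H); rewrite ler_wpM2l ?addr_ge0// normr_le_enorm.
Qed.

Lemma locally_lipschitz_continuous (V : 'rV[R]_d -> R) :
  [locally [lipschitz V x | x in [set: 'rV[R]_d]]] -> continuous V.
Proof.
move=> lip; suff cV (z : 'rV[R]_d) : V y @[y --> z] --> V z by move=> z; exact: cV.
have [L L0 [[A B] /= [Az Bz] AB]] := lipschitz_near_diagonal V lip z.
apply/(@cvgrPdist_lt _ _ _ (nbhs z) (nbhs_filter z)) => e e0.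
have eL : 0 < (e / L) ^+ 2 by rewrite exprn_gt0// divr_gt0.
have nb : nbhs z (B `&` [set y | sqdist z y < (e / L) ^+ 2]).
  by apply: filterI => //; exact: sqdist_near.
apply: (@filterS _ (nbhs z) (nbhs_filter z) _ _ _ nb) => y [By zy].
have /= VL := AB (z, y) (conj (nbhs_singleton Az) By).
apply: le_lt_trans VL _.
rewrite -ltr_pdivlMl// mulrC -ltr_sqr ?nnegrE ?enorm_ge0//; last by rewrite ltW// divr_gt0.
by rewrite sqr_enorm -/(sqdist y z) sqdistC.
Qed.

#[global] Instance at_infinity_filter : Filter (@at_infinity R d).
Proof.
apply: filter_from_filter => [|r s _ _]; first by exists 0.
exists (Num.max r s) => // x /=; rewrite gt_max => /andP[rx sx]; split; exact.
Qed.

Lemma at_infinity_ex (P : set 'rV[R]_d) : at_infinity P ->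
  exists2 r, 0 <= r & forall x, r < enorm x -> P x.
Proof.
move=> [r _ rP]; exists (Num.max r 0); first by rewrite le_max lexx orbT.
by move=> x; rewrite gt_max => /andP[rx _]; exact: rP.
Qed.

Lemma at_infinity_gt f : (0 < limf_einf (fun x => (f x)%:E) at_infinity)%E ->
  \forall x \near at_infinity, 0 < f x.
Proof.
rewrite /limf_einf oppe_gt0 => /ereal_inf_lt[_ [A inA <-]] supA.
apply: filterS inA => x Ax.
have : (- (f x)%:E < 0)%E.
  by apply: le_lt_trans supA; apply: ereal_sup_ubound; exists x.
by rewrite oppe_lt0 lte_fin.
Qed.

End Diagonal.

(** * Comparison of [u] with [theta V] by doubling the variables *)

Section Comparison.
Context {R : realType} {d : nat}.
Implicit Types (x y z m v w g : 'rV[R]_d) (f C : 'rV[R]_d -> R).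

(** The bound outside the ball localizes the doubling: the maximum point [x] falls in the ball and
    its competitors in the compact set [K]. The limit of large [N] is replaced by one small [e],
    fixed beforehand. *)
Lemma comparison (gamma beta theta rho : R) (q : 'rV[R]_d -> 'rV[R]_d)
    (c V u : 'rV[R]_d -> R) :
  gamma <= 2 -> 0 < beta -> beta <= 3 - gamma -> continuous q -> continuous c ->
  (forall x, c x < 0) -> (forall x, 0 <= V x) ->
  [locally [lipschitz V x | x in [set: 'rV[R]_d]]] ->
  visc_supersolution gamma
     (fun x r p => dot (q x) p * enorm p `^ (2 - gamma) + c x * r `^ beta) V ->
  continuous u ->
  visc_subsolution gamma
     (fun x r p => dot (q x) p * enorm p `^ (2 - gamma) + c x * pos_part r `^ beta) u ->
  0 < theta <= 1 -> 0 <= rho ->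
  (forall x, rho < sqdist 0 x -> u x <= theta * V x) ->
  forall x, u x <= theta * V x.
Proof.
move=> gamma2 beta0 betag cq cc c0 V0 Vlip Vsup cu usub th rho0 uV x1.
have /andP[th0 th1] := th.
have cV := locally_lipschitz_continuous V Vlip.
have cW : continuous (fun x => theta * V x).
  by move=> x; exact: (cvgM (cvg_cst theta) (cV x)).
set W := fun x => theta * V x in cW *.
have W0 x : 0 <= W x by rewrite /W mulr_ge0// ltW.
rewrite leNgt; apply/negP => uW1.
pose M0 := u x1 - W x1; have M00 : 0 < M0 by rewrite subr_gt0.
(* By [sqdistD], a point within squared distance [3 / 2] of the ball of squared radius [rho] stays
   in [K]. *)
pose K := [set x : 'rV[R]_d | sqdist 0 x <= 2 * rho + 3].
have cK : compact K by exact: compact_sqdist_le.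
have x1rho : sqdist 0 x1 <= rho by rewrite leNgt; apply/negP => /uV; rewrite leNgt uW1.
have rho3 : rho <= 2 * rho + 3 by clear - rho0; lra.
have Kx1 : K x1 by exact: le_trans x1rho rho3.
(* A single scale e serves as distance bound and as inverse Lipschitz constant. *)
have lipe : \forall e \near (0 : R)^'+, forall x y, K x -> sqdist x y < e ->
    `|W x - W y| <= e^-1 * enorm (x - y).
  apply: (diagonal_uniform K (fun e x y => `|W x - W y| <= e^-1 * enorm (x - y)) cK).
  move=> z _; have [L L0 [[A B] /= [Az Bz] AB]] := lipschitz_near_diagonal V Vlip z.
  have [a a0 aA] := near_sqdist _ _ Az; have [b b0 bB] := near_sqdist _ _ Bz.
  exists (Num.min (Num.min a b) L^-1); first by rewrite !lt_min a0 b0 invr_gt0.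
  move=> e x y; rewrite !lt_min => /andP[e0 /andP[_ eL]].
  move=> /andP[/andP[xa _] _] /andP[/andP[_ yb] _].
  have /= H := AB (x, y) (conj (aA _ xa) (bB _ yb)).
  rewrite /W -mulrBr normrM gtr0_norm//; apply: le_trans (ler_piMl _ th1) _ => //.
  apply: le_trans H _; rewrite ler_wpM2r ?enorm_ge0//.
  by rewrite -[leLHS]invrK lef_pV2 ?posrE ?invr_gt0// ltW.
have [e1 [/= e10 lip]] : exists e, 0 < e /\ forall x y, K x -> sqdist x y < e ->
    `|W x - W y| <= e^-1 * enorm (x - y).
  by apply: (@filter_ex _ (0^'+)); apply: filterI lipe; exact: nbhs_right_gt.
(* A bound for the gradient norm [4 N |x - y|^3]. *)
pose P := 4 * e1^-1.
have P0 : 0 < P by rewrite mulr_gt0// invr_gt0.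
have near1 (f : 'rV[R]_d -> R) z z' : continuous f -> f p.1 @[p --> (z, z')] --> f z.
  by move=> cf; apply: (cvg_comp fst f) (cf z); exact: cvg_fst.
have near2 (f : 'rV[R]_d -> R) z' z : continuous f -> f p.2 @[p --> (z', z)] --> f z.
  by move=> cf; apply: (cvg_comp snd f) (cf z); exact: cvg_snd.
have We : \forall e \near (0 : R)^'+, forall x y, K x -> sqdist x y < e -> W x - W y < M0.
  apply: (diagonal_uniform_near K (fun x y => W x - W y < M0) cK) => z _.
  have WW : W p.1 - W p.2 @[p --> (z, z)] --> W z - W z.
    exact: (cvgB (near1 _ _ _ cW) (near2 _ _ _ cW)).
  by apply: (cvgr_lt _ WW); rewrite subrr.
(* An upper bound for the doubled inequality, with [W y] replaced by the larger positive number
   [u x - M0 / 2]. On the diagonal only the difference of powers multiplied by [c] remains, which is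
   negative. *)
pose Z x y := c x * u x `^ beta - c y * (u x - M0 / 2) `^ beta
  + P `^ (2 - gamma) * (P * enorm (q x - q y)).
have Ze : \forall e \near (0 : R)^'+, forall x y, K x -> sqdist x y < e ->
    M0 <= u x - W y -> Z x y < 0.
  apply: (diagonal_uniform_near K (fun x y => M0 <= u x - W y -> Z x y < 0) cK) => z _.
  have [uWz|uWz] := ltP (u z - W z) M0.
    have uW : u p.1 - W p.2 @[p --> (z, z)] --> u z - W z.
      exact: (cvgB (near1 _ z z cu) (near2 _ z z cW)).
    have nM : \forall p \near (z, z), u p.1 - W p.2 < M0 by exact: (cvgr_lt _ uW).
    by apply: filterS nM => p pM; rewrite leNgt pM.
  have uz : M0 <= u z by apply: le_trans uWz _; rewrite gerBl.
  have uz0 : 0 < u z := lt_le_trans M00 uz.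
  have uz1 : 0 < u z - M0 / 2 by clear - uz M00; lra.
  have q1 : q p.1 @[p --> (z, z)] --> q z.
    by apply: (cvg_comp fst q) (cq z); exact: cvg_fst.
  have q2 : q p.2 @[p --> (z, z)] --> q z.
    by apply: (cvg_comp snd q) (cq z); exact: cvg_snd.
  have Zz : Z z z < 0.
    rewrite /Z subrr /enorm dot0l sqrtr0 !mulr0 addr0 -mulrBr nmulr_rlt0//.
    rewrite subr_gt0; apply: gt0_ltr_powR => //; rewrite ?nnegrE ?ltW//.
    by rewrite gtrBl divr_gt0.
  have ZZ : Z p.1 p.2 @[p --> (z, z)] --> Z z z.
    have p1 : u p.1 `^ beta @[p --> (z, z)] --> u z `^ beta.
      by apply: cvg_powR => //; exact: near1.
    have u2 : u p.1 - M0 / 2 @[p --> (z, z)] --> u z - M0 / 2.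
      exact: (cvgB (near1 u z z cu) (cvg_cst (M0 / 2))).
    have p2 : (u p.1 - M0 / 2) `^ beta @[p --> (z, z)] --> (u z - M0 / 2) `^ beta.
      exact: cvg_powR.
    have qq : enorm (q p.1 - q p.2) @[p --> (z, z)] --> enorm (q z - q z).
      by apply: cvg_enorm; exact: (cvgB q1 q2).
    exact: (cvgD (cvgB (cvgM (near1 c z z cc) p1) (cvgM (near2 c z z cc) p2))
      (cvgM (cvg_cst (P `^ (2 - gamma))) (cvgM (cvg_cst P) qq))).
  have nZ : \forall p \near (z, z), Z p.1 p.2 < 0 by exact: (cvgr_lt _ ZZ).
  by apply: filterS nZ.
have [e [e0 e1' ee1 We' Ze']] : exists e, [/\ 0 < e, e < 1, e < e1,
    forall x y, K x -> sqdist x y < e -> W x - W y < M0 &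
    forall x y, K x -> sqdist x y < e -> M0 <= u x - W y -> Z x y < 0].
  apply: (@filter_ex _ (0^'+)); near=> e; split.
  - by near: e; exact: nbhs_right_gt.
  - by near: e; exact: nbhs_right_lt.
  - by near: e; exact: nbhs_right_lt.
  - by near: e.
  - by near: e.
have [xm Kxm um] := continuous_max_on u K (ex_intro _ x1 Kx1) cK cu.
have U0 : 0 < u xm by exact: lt_le_trans (le_lt_trans (W0 x1) uW1) (um _ Kx1).
(* At squared distance [e] the penalty exceeds the maximum of [u] over [K], which forces
   [sqdist x y < e]. *)
pose N := (u xm + 1) / e ^+ 2.
have N0 : 0 < N by rewrite divr_gt0 ?exprn_gt0// addr_gt0.
pose F (p : 'rV[R]_d * 'rV[R]_d) := u p.1 - W p.2 - N * sqdist p.1 p.2 ^+ 2.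
have cF : continuous F.
  move=> [a b].
  have S : sqdist p.1 p.2 @[p --> (a, b)] --> sqdist a b.
    have p1 : fst @ (a, b) --> a by exact: cvg_fst.
    have p2 : snd @ (a, b) --> b by exact: cvg_snd.
    by apply: cvg_dot; exact: (cvgB p2 p1).
  exact: (cvgB (cvgB (near1 _ _ _ cu) (near2 _ _ _ cW))
    (cvgM (cvg_cst N) (cvgM S S))).
have [x [y [Kx Ky Fm]]] : exists x y : 'rV[R]_d, [/\ K x, K y &
    forall z w, K z -> K w ->
      u z - W w - N * sqdist z w ^+ 2 <= u x - W y - N * sqdist x y ^+ 2].
  have [|[x y] + Fm] := compact_EVT_max (f := F) _ (compact_setX cK cK)
    (continuous_subspaceT cF); first by exists (x1, x1).
  rewrite inE => -[/= Kx Ky]; exists x, y; split=> // z w Kz Kw.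
  by have := Fm (z, w); rewrite inE; apply; split.
have Fx1 : M0 <= u x - W y - N * sqdist x y ^+ 2.
  by have := Fm _ _ Kx1 Kx1; rewrite sqdistxx expr0n/= mulr0 subr0.
have S2 : 0 <= N * sqdist x y ^+ 2 by rewrite mulr_ge0 ?sqr_ge0// ltW.
have uxW : M0 <= u x - W y by clear - Fx1 S2; lra.
have ux0 : 0 < u x by clear - uxW M00 W0; have := W0 y; lra.
have Se : sqdist x y < e.
  rewrite -ltr_sqr ?nnegrE ?sqdist_ge0 ?ltW//.
  have : N * sqdist x y ^+ 2 < u xm + 1.
    by have := um _ Kx; have := W0 y; clear - Fx1 M00; lra.
  by rewrite /N mulrAC ltr_pdivrMr ?exprn_gt0// ltr_pM2l// addr_gt0.
have Zxy := Ze' _ _ Kx Se uxW.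
(* Outside the ball [u x <= W x], against [W x - W y < M0 <= u x - W y]. *)
have xrho : sqdist 0 x <= rho.
  rewrite leNgt; apply/negP => /uV; rewrite -/(W x).
  by have := We' _ _ Kx Se; clear - uxW; lra.
have Kclose z : sqdist x z <= 3 / 2 * sqdist x y -> K z.
  move=> xz; rewrite /K /=; have := sqdistD x 0 z; rewrite (sqdistC x 0).
  by clear - xz xrho Se e1'; lra.
have [xy|xy] := eqVneq x y.
  have : \forall z \near x, u z <= u x + N * sqdist x z ^+ 2.
    have nK : \forall z \near x, sqdist x z < 1 by exact: sqdist_near.
    apply: filterS nK => z xz.
    have Kz : K z.
      rewrite /K /=; have := sqdistD x 0 z; rewrite (sqdistC x 0).
      by clear - xz xrho; lra.
    have := Fm _ _ Kz Ky; rewrite -xy sqdistxx expr0n/= mulr0 sqdistC.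
    by clear; lra.
  move=> /(zero_grad_subsolution _ _ _ _ _ _ _ usub).
  rewrite leNgt => /negP; apply; rewrite nmulr_rlt0// powR_gt0//.
  by rewrite lt_max ux0.
pose m := 2^-1 *: (x + y).
have mx : sqdist m x = sqdist x y / 4 by exact: sqdist_midpoint.
have Kball z : sqdist m z <= 2 * sqdist m x -> K z.
  move=> mz; apply: Kclose; have := sqdistD m x z.
  by clear - mz mx; lra.
have sub1 := quad_sub_subsolution _ _ _ _ _ usub.
have sub2 := quad_sub_supersolution _ _ _ _ _ _ c0 V0 betag th Vsup.
(* The two errors [eps] in the local bounds still leave [Z x y / 2 < 0]. *)
pose eps := - Z x y / 4.
have eps0 : 0 < eps by rewrite divr_gt0 ?oppr_gt0.
pose b := u x - M0 / 2.
have b0 : 0 < b by rewrite /b; clear - uxW M00 W0; have := W0 y; lra.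
have Wb : W y < b by rewrite /b; clear - uxW M00; lra.
have C1 : \forall z \near x, c z * pos_part (u z) `^ beta <= c x * u x `^ beta + eps.
  have L : c z * u z `^ beta @[z --> x] --> c x * u x `^ beta.
    have pu : u z `^ beta @[z --> x] --> u x `^ beta.
      exact: (@cvg_powR R _ (nbhs x) (nbhs_filter x) u (u x) beta ux0 (cu x)).
    exact: (cvgM (cc x) pu).
  have n1 : \forall z \near x, c z * u z `^ beta < c x * u x `^ beta + eps.
    by apply: (cvgr_lt _ L); rewrite ltrDl.
  have n2 : \forall z \near x, 0 < u z by exact: (cvgr_gt _ (cu x)).
  apply: filterS (filterI n1 n2) => z [z1 z2].
  by rewrite /pos_part max_l ?ltW.
have C2 : \forall z \near y, - (c z * (theta * V z) `^ beta) <= - (c y * b `^ beta) + eps.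
  have L : - (c z * b `^ beta) @[z --> y] --> - (c y * b `^ beta).
    exact: (cvgN (cvgM (cc y) (cvg_cst (b `^ beta)))).
  have n1 : \forall z \near y, - (c z * b `^ beta) < - (c y * b `^ beta) + eps.
    by apply: (cvgr_lt _ L); rewrite ltrDl.
  have n2 : \forall z \near y, W z < b by exact: (cvgr_lt _ (cW y)).
  apply: filterS (filterI n1 n2) => z [z1 z2]; apply: le_trans (ltW z1).
  rewrite lerN2 ler_nM2l//; apply: ge0_ler_powR;
    rewrite ?nnegrE ?(ltW beta0) ?(ltW b0) ?(ltW z2)//.
  exact: W0.
have cW' : continuous (fun z => - W z) by move=> z; exact: (cvgN (cW z)).
have ball z w : sqdist m z <= 2 * sqdist m x -> sqdist m w <= 2 * sqdist m x ->
    u z + - W w - N * sqdist z w ^+ 2 <= u x + - W y - N * sqdist x y ^+ 2.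
  by move=> /Kball Kz /Kball Kw; exact: Fm.
have := doubling_max gamma q u _ (fun x => - W x) _ x y N _ _ N0 xy cq cu cW' sub1 sub2
  ball C1 C2.
rewrite leNgt => /negP; apply.
set g := (4 * N * sqdist x y) *: (x - y).
have gP : enorm g <= P.
  have n0 : 0 < enorm (x - y) by rewrite enorm_gt0 subr_eq0.
  have nE : sqdist x y = enorm (x - y) ^+ 2 by rewrite sqr_enorm sqdistC.
  have N4 : 0 <= 4 * N * sqdist x y by rewrite mulr_ge0 ?sqdist_ge0// mulr_ge0 ?(ltW N0).
  rewrite /g enormZ ger0_norm//.
  (* Comparison with the pair [(x, x)] gives [N |x - y|^4 <= W x - W y]; the Lipschitz bound and
     division by [|x - y|] give the gradient bound. *)
  have := Fm _ _ Kx Kx; rewrite sqdistxx expr0n/= mulr0 subr0 => Fxx.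
  have := lip _ _ Kx (lt_trans Se ee1) => /(le_trans (ler_norm _)) Lxy.
  have : N * enorm (x - y) ^+ 3 * enorm (x - y) <= e1^-1 * enorm (x - y).
    rewrite -mulrA -exprSr (exprM _ 2 2) -nE.
    by clear - Fxx Lxy; lra.
  rewrite ler_pM2r// => H.
  rewrite [leLHS](_ : _ = 4 * (N * enorm (x - y) ^+ 3)); last by rewrite nE; ring.
  by rewrite /P ler_pM2l.
have hP : enorm g `^ (2 - gamma) <= P `^ (2 - gamma).
  by apply: ge0_ler_powR; rewrite ?nnegrE ?subr_ge0 ?enorm_ge0 ?(ltW P0).
have qg : dot (q x - q y) g <= P * enorm (q x - q y).
  apply: le_trans (ler_norm _) _; apply: le_trans (normr_dot_le _ _) _.
  by rewrite mulrC ler_wpM2r ?enorm_ge0.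
have hq : enorm g `^ (2 - gamma) * dot (q x - q y) g
    <= P `^ (2 - gamma) * (P * enorm (q x - q y)).
  apply: (@le_trans _ _ (enorm g `^ (2 - gamma) * (P * enorm (q x - q y)))).
    by rewrite ler_wpM2l// powR_ge0.
  by rewrite ler_wpM2r// mulr_ge0 ?enorm_ge0// ltW.
have epsE : 2 * eps = - Z x y / 2 by rewrite /eps; field.
have ZE : Z x y = c x * u x `^ beta - c y * b `^ beta
  + P `^ (2 - gamma) * (P * enorm (q x - q y)) by [].
clear - hq epsE ZE Zxy; lra.
Unshelve. all: by end_near. Qed.

End Comparison.

(** * Strong maximum principle and Liouville property *)

Section LnBound.
Context {R : realType} {d : nat}.
Implicit Types (x y z m v w g : 'rV[R]_d) (f C : 'rV[R]_d -> R).

(** The second derivative of [ln] at [a] is [- 1 / a^2], strictly below [- kappa / a^2]; the mean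
    value theorem on each side of [a] concludes. This replaces the logarithmic barrier by a
    polynomial test function. *)
Lemma ln_le_quadratic (a kappa : R) : 0 < a -> 0 <= kappa < 1 ->
  \forall t \near a, ln t <= ln a + a^-1 * (t - a) - kappa / a ^+ 2 / 2 * (t - a) ^+ 2.
Proof.
move=> a0 /andP[k0 k1].
pose f (t : R) := a^-1 * (t - a) - kappa / a ^+ 2 / 2 * (t - a) ^+ 2 - ln t.
pose f' (t : R) := a^-1 - kappa / a ^+ 2 * (t - a) - t^-1.
have df (t : R) : 0 < t -> is_derive t 1 f (f' t).
  move=> t0.
  pose cs (e : R) : R -> R := cst e.
  have dc e : is_derive t 1 (cs e) 0 by exact: is_derive_cst.
  have di : is_derive t 1 (@id R) 1 by exact: is_derive_id.
  have dta := is_deriveB di (dc a).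
  have D := is_deriveB (is_deriveB (is_deriveM (dc a^-1) dta)
    (is_deriveM (dc (kappa / a ^+ 2 / 2)) (is_deriveM dta dta))) (is_derive1_ln t0).
  rewrite (_ : f = (cs a^-1 * (id - cs a) - cs (kappa / a ^+ 2 / 2) *
    ((id - cs a) * (id - cs a))) - @ln R); last first.
    by apply/funext => e; rewrite /f /cs !fctE expr2.
  apply: is_derive_eq D _; rewrite /f' /cs /GRing.scale/= !fctE/=.
  by field; rewrite !gt_eqF.
have f'E (t : R) : 0 < t -> f' t * (t - a) = (t - a) ^+ 2 * (a - kappa * t) / (a ^+ 2 * t).
  by move=> t0; rewrite /f'; field; rewrite !gt_eqF.
have fcont (t s : R) : 0 < t -> {within `[t, s], continuous f}.
  move=> t0; apply: derivable_within_continuous => e; rewrite in_itv/= => /andP[te _].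
  by have [] := df e (lt_le_trans t0 te).
have fa : f a = - ln a by rewrite /f subrr mulr0 expr0n/= mulr0 subr0 sub0r.
have a2 : 0 < a / 2 by rewrite divr_gt0.
near=> t.
have t0 : 0 < t by near: t; exact: lt_nbhsr.
have kt : kappa * t < a.
  near: t; have L : kappa * t @[t --> a] --> kappa * a.
    by apply: cvgM; [exact: cvg_cst|exact: cvg_id].
  by apply: (cvgr_lt _ L); rewrite gtr_pMl.
suff : - ln a <= f t by rewrite /f; clear; lra.
rewrite -fa.
have pos (e : R) : 0 < e -> kappa * e <= a -> 0 <= f' e * (e - a).
  move=> e0 ke; rewrite f'E// divr_ge0//; last by rewrite mulr_ge0 ?exprn_ge0 ?ltW.
  by rewrite mulr_ge0 ?sqr_ge0// subr_ge0.
have [ta|at_|->] := ltgtP t a; last exact: lexx.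
- have [e|c] := MVT ta (df := f') _ (fcont _ _ t0).
    by rewrite in_itv/= => /andP[tc _]; apply: df; exact: lt_trans tc.
  rewrite in_itv/= => /andP[tc ca] E.
  have c0 : 0 < c by exact: lt_trans tc.
  have kc : kappa * c <= a.
    by apply: le_trans (ltW ca); rewrite ler_piMl ?ltW.
  have := pos c c0 kc; rewrite nmulr_lge0 ?subr_lt0// => fc.
  by rewrite -subr_le0 E; apply: mulr_le0_ge0 => //; rewrite subr_ge0 ltW.
- have [e|c] := MVT at_ (df := f') _ (fcont _ _ a0).
    by rewrite in_itv/= => /andP[tc _]; apply: df; exact: lt_trans tc.
  rewrite in_itv/= => /andP[ac ct] E.
  have c0 : 0 < c by exact: lt_trans ac.
  have kc : kappa * c <= a.
    by apply: le_trans (ltW kt); rewrite ler_wpM2l// ltW.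
  have := pos c c0 kc; rewrite pmulr_lge0 ?subr_gt0// => fc.
  by rewrite -subr_ge0 E; apply: mulr_ge0 => //; rewrite subr_ge0 ltW.
Unshelve. all: by end_near. Qed.

End LnBound.

(** * Strong maximum principle at an interior touching ball *)

Section StrongMaximum.
Context {R : realType} {d : nat}.
Implicit Types (x y z m v w g : 'rV[R]_d) (u C : 'rV[R]_d -> R).

Lemma eikonal_lt0 gamma (q : 'rV[R]_d -> 'rV[R]_d) C y m (s k : R) :
  s != 0 -> y != m -> C y <= 0 ->
  2 * s + 4 * k * sqdist m y + 2 * s * dot (q y) (y - m) < 0 ->
  enorm ((2 * s) *: (y - m)) `^ (2 - gamma) *
    (2 * s + 4 * k * sqdist m y + dot (q y) ((2 * s) *: (y - m))) + C y < 0.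
Proof.
move=> s0 ym Cy lt0; rewrite dotZr -[ltRHS]addr0; apply: ltr_leD => //.
rewrite pmulr_rlt0// powR_gt0// enorm_gt0 scaler_eq0 negb_or subr_eq0 ym andbT.
by rewrite mulf_neq0.
Qed.

(** Take [x] in [A] nearest to [y0], and [m] the midpoint of [y0] and [x]: the ball around [m]
    through [x] meets the sphere around [y0] through [x] only at [x]. *)
Lemma interior_touching_ball (A : set 'rV[R]_d) x0 y0 : closed A -> A x0 -> ~ A y0 ->
  exists x m, [/\ A x, x != m & forall z, sqdist m z <= sqdist m x -> z != x -> ~ A z].
Proof.
move=> clA Ax0 Ay0.
have [|||x [xx0 Ax] xmin] := continuous_max_on (fun z => - sqdist y0 z)
    ([set z | sqdist y0 z <= sqdist y0 x0] `&` A).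
- by exists x0; split => //=.
- by apply: compact_closedI => //; exact: compact_sqdist_le.
- by move=> z; exact: (cvgN (@sqdist_continuous R d y0 z)).
rewrite /= in xx0; exists x, (2^-1 *: (y0 + x)); set m := 2^-1 *: _.
have xy0 : x != y0 by apply/eqP => E; apply: Ay0; rewrite -E.
have my : sqdist m y0 = sqdist y0 x / 4 by exact: sqdist_midpoint.
have mx : sqdist m x = sqdist y0 x / 4 by rewrite /m addrC sqdist_midpoint sqdistC.
have mE : 2 *: m - y0 = x.
  by rewrite /m scalerA divff ?scale1r ?pnatr_eq0// addrAC subrr add0r.
split=> //; first by rewrite -sqdist_gt0 mx divr_gt0// sqdist_gt0.
move=> z mz zx Az.
have xz : 0 < sqdist x z by rewrite sqdist_gt0.
have lt : sqdist y0 z < sqdist y0 x.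
  rewrite (sqdist_parallelogram m y0 z) mE my; rewrite mx in mz.
  by clear - mz xz; lra.
have := xmin z; rewrite lerN2 leNgt lt => /(_ _)/negP; apply=> //.
by split => //=; exact: le_trans (ltW lt) xx0.
Qed.

(** A Hopf-type argument at a ball touching the set where [u = M]: subtracting a small multiple of
    the barrier [P] from [u] produces an interior maximum near [x] at which the tested inequality
    fails. *)
Lemma strong_maximum gamma q u C x0 (M : R) :
  continuous q -> continuous u -> quad_sub gamma q u C -> (forall z, C z <= 0) ->
  (forall z, u z <= M) -> u x0 = M -> forall y0, u y0 = M.
Proof.
move=> cq cu usub C0 uM ux0 y0; apply/eqP; rewrite eq_le uM/= leNgt; apply/negP => uy0.
have clA : closed [set z | M <= u z].
  apply: (@closed_comp _ _ u [set r | M <= r]); last exact: closed_ge.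
  by move=> z _; exact: cu.
have [||x [m [/= Mx xm ball]]] := interior_touching_ball _ x0 y0 clA.
- by rewrite /= ux0.
- by rewrite /= leNgt uy0.
have {}ball z : sqdist m z <= sqdist m x -> z != x -> u z < M.
  by move=> mz zx; rewrite ltNge; apply/negP; exact: ball.
have a0 : 0 < sqdist m x by rewrite sqdist_gt0.
set a := sqdist m x in a0 ball.
pose D := `|dot (q x) (x - m)|.
(* Then [4 k a = - 2 (2 + D)], and the tested bracket at [x] with slope 1 is at most [- 2]. *)
pose k := - (2 + D) / (2 * a).
have D0 : 0 < 2 + D by rewrite ltr_wpDr// normr_ge0.
have k0 : k < 0 by rewrite /k mulNr oppr_lt0 divr_gt0// mulr_gt0.
have cT : sqdist m z @[z --> x] --> sqdist m x by exact: sqdist_continuous.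
have cl : 1 + k * (sqdist m z - a) @[z --> x] --> 1 + k * (a - a).
  exact: (cvgD (cvg_cst (1 : R)) (cvgM (cvg_cst k) (cvgB cT (cvg_cst a)))).
have cdot : dot (q z) (z - m) @[z --> x] --> dot (q x) (x - m).
  apply: (@cvg_dot R d _ (nbhs x) (nbhs_filter x)); first exact: cq.
  exact: (cvgB cvg_id (cvg_cst m)).
have n1 : \forall z \near x, 0 < 1 + k * (sqdist m z - a).
  by apply: (cvgr_gt _ cl); rewrite subrr mulr0 addr0.
have n2 : \forall z \near x, 2 * (1 + k * (sqdist m z - a)) + 4 * k * sqdist m z
    + 2 * (1 + k * (sqdist m z - a)) * dot (q z) (z - m) < 0.
  have L : 2 * (1 + k * (sqdist m z - a)) + 4 * k * sqdist m z
      + 2 * (1 + k * (sqdist m z - a)) * dot (q z) (z - m) @[z --> x] -->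
      2 * (1 + k * (a - a)) + 4 * k * a + 2 * (1 + k * (a - a)) * dot (q x) (x - m).
    exact: (cvgD (cvgD (cvgM (cvg_cst (2 : R)) cl) (cvgM (cvg_cst (4 * k)) cT))
      (cvgM (cvgM (cvg_cst (2 : R)) cl) cdot)).
  apply: (cvgr_lt _ L); rewrite subrr mulr0 addr0.
  rewrite (_ : 4 * k * a = - (2 * (2 + D))); last first.
    by rewrite /k; field; rewrite gt_eqF.
  by have := ler_norm (dot (q x) (x - m)); rewrite -/D; clear; lra.
have n3 : \forall z \near x, 0 < sqdist m z by exact: (cvgr_gt _ cT).
have [r r0 rP] := near_sqdist _ _ (filterI (filterI n1 n2) n3).
(* Zero on the sphere of the touching ball and, near [x], positive outside it. *)
pose P z := sqdist m z - a + k / 2 * (sqdist m z - a) ^+ 2.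
have PE z : P z = (sqdist m z - a) * (1 + (1 + k * (sqdist m z - a))) / 2.
  by rewrite /P; field.
have cP : continuous P.
  move=> z; have T := @sqdist_sub_continuous R d m x z; rewrite -/a in T.
  exact: (cvgD T (cvgM (cvg_cst (k / 2)) (cvgM T T))).
have r20 : 0 < r / 2 by rewrite divr_gt0.
have r2r : r / 2 < r by rewrite ltr_pdivrMr// ltr_pMr// ltr1n.
(* This part of the small sphere is compact, lies in the closed touching ball and avoids [x]. *)
have [M' M'M uM'] : exists2 M', M' < M & forall z, sqdist x z = r / 2 ->
    sqdist m z <= a -> u z <= M'.
  pose S := [set z | sqdist x z <= r / 2] `&` ([set z | r / 2 <= sqdist x z]
    `&` [set z | sqdist m z <= a]).
  have cS : compact S.
    apply: compact_closedI; first exact: compact_sqdist_le.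
    by apply: closedI; [exact: closed_sqdist_ge|exact: closed_sqdist_le].
  have [S0|/set0P S0] := eqVneq S set0.
    exists (M - 1); first by rewrite gtrBl.
    move=> z xz mz; suff : S z by rewrite S0.
    by split; rewrite /= ?xz.
  have [w [w1 [w2 w3]] wm] := continuous_max_on u S S0 cS cu.
  exists (u w) => [|z xz mz]; last by apply: wm; split; rewrite /= ?xz.
  apply: ball => //; rewrite -sqdist_gt0; exact: lt_le_trans w2.
pose B := a + `|k| / 2 * a ^+ 2.
have B0 : 0 < B by rewrite ltr_wpDr// mulr_ge0 ?sqr_ge0// divr_ge0.
(* In the touching ball [- P <= B], so the perturbation there is at most half of the gap
   [M - M']. *)
pose eta := (M - M') / (2 * B).
have eta0 : 0 < eta by rewrite divr_gt0 ?subr_gt0// mulr_gt0.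
have etaB : eta * B = (M - M') / 2 by rewrite /eta; field; rewrite gt_eqF.
have [||y Ky ym] := continuous_max_on (fun z => u z - eta * P z)
    [set z | sqdist x z <= r / 2] _ (compact_sqdist_le _ _).
- by exists x; rewrite /= sqdistxx ltW.
- by move=> z; exact: (cvgB (cu z) (cvgM (cvg_cst eta) (cP z))).
rewrite /= in Ky.
have yr : sqdist x y < r by exact: le_lt_trans r2r.
have [[y1 y2] y3] := rP y yr.
have gy : M <= u y - eta * P y.
  apply: le_trans (ym x _); last by rewrite /= sqdistxx ltW.
  by rewrite /P -/a subrr expr0n/= !mulr0 addr0 mulr0 subr0.
have {}Ky : sqdist x y < r / 2.
  rewrite lt_neqAle Ky andbT; apply/eqP => xy.
  have [ya|ya] := leP (sqdist m y) a.
    have Mu := uM' _ xy ya.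
    have PB : - P y <= B.
      have kT : - (k / 2 * (sqdist m y - a) ^+ 2) <= `|k| / 2 * a ^+ 2.
        rewrite -mulNr -mulNr; apply: ler_pM.
        - by rewrite divr_ge0// oppr_ge0 ltW.
        - exact: sqr_ge0.
        - by rewrite ler_pM2r ?invr_gt0// -normrN ler_norm.
        - rewrite -sqrrN opprB lerXn2r ?nnegrE ?subr_ge0 ?(ltW a0)//.
          by rewrite gerBl sqdist_ge0.
      have := sqdist_ge0 m y.
      rewrite /P /B; clear - kT; lra.
    have := ler_wpM2l (ltW eta0) PB; rewrite etaB.
    by clear - gy Mu M'M; lra.
  have P0 : 0 < eta * P y.
    rewrite mulr_gt0// PE divr_gt0// mulr_gt0 ?subr_gt0//.
    by rewrite addr_gt0.
  by have := uM y; clear - P0 gy; lra.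
pose s := eta * (1 + k * (sqdist m y - a)).
have s0 : s != 0 by rewrite mulf_neq0// gt_eqF.
have ym0 : y != m by rewrite -sqdist_gt0.
have touch : \forall z \near y, u z <= u y + s * (sqdist m z - sqdist m y)
    + eta * k / 2 * (sqdist m z - sqdist m y) ^+ 2.
  have nz : \forall z \near y, sqdist x z < r / 2.
    exact: (cvgr_lt _ (@sqdist_continuous R d x y)).
  apply: filterS nz => z /ltW /ym; rewrite /P /s; clear; lra.
have := usub y m s (eta * k) s0 ym0 touch.
rewrite leNgt => /negP; apply; apply: eikonal_lt0 => //.
rewrite (_ : _ + _ = eta * (2 * (1 + k * (sqdist m y - a)) + 4 * k * sqdist m y
    + 2 * (1 + k * (sqdist m y - a)) * dot (q y) (y - m))); last first.
  by rewrite /s; ring.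
by rewrite pmulr_rlt0.
Qed.

End StrongMaximum.

(** * Liouville property with a logarithmic barrier *)

Section Liouville.
Context {R : realType} {d : nat}.
Implicit Types (x y z m v w g : 'rV[R]_d) (u C : 'rV[R]_d -> R).

(** The function [u - e ln |z|^2] is maximized over an annulus. The bound [M] excludes the inner
    sphere, [u <= 0] and the size of [R2] the outer one; inside, the barrier is strict because
    [dot (q z) z <= b < 1]. *)
Lemma exterior_maximum gamma (q : 'rV[R]_d -> 'rV[R]_d) u C (b rho M : R) :
  0 <= b < 1 -> 0 < rho -> continuous u -> quad_sub gamma q u C ->
  (forall z, C z <= 0) -> (forall z, u z <= 0) ->
  (forall z, rho < sqdist 0 z -> dot (q z) z <= b) ->
  (forall z, sqdist 0 z <= rho -> u z <= M) -> forall z, u z <= M.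
Proof.
move=> /andP[b0 b1] rho0 cu usub C0 u0 qb uM x.
have [|xrho] := leP (sqdist 0 x) rho; first exact: uM.
rewrite leNgt; apply/negP => Mx.
pose L := ln (sqdist 0 x) - ln rho.
have x0 : 0 < sqdist 0 x := lt_trans rho0 xrho.
have L0 : 0 < L by rewrite subr_gt0 ltr_ln.
(* The barrier uses half of the excess of [u x] over [M], so the value at [x] still beats
   [M - e ln rho]. *)
pose e := (u x - M) / (2 * L).
have e0 : 0 < e by rewrite divr_gt0 ?subr_gt0// mulr_gt0.
have eL : e * L = (u x - M) / 2 by rewrite /e; field; rewrite gt_eqF.
(* The second summand ensures [e ln R2 >= e ln rho + |M|]; the first keeps [x] inside the
   annulus. *)
pose R2 := sqdist 0 x + rho * expR (`|M| / e).
have pE : 0 < rho * expR (`|M| / e) by rewrite mulr_gt0 ?expR_gt0.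
have xR2 : sqdist 0 x < R2 by rewrite ltrDl.
have R20 : 0 < R2 := lt_trans x0 xR2.
have lnR2 : e * ln rho + `|M| <= e * ln R2.
  have : ln (rho * expR (`|M| / e)) <= ln R2 by rewrite ler_ln// lerDr ltW.
  rewrite lnM ?posrE ?expR_gt0// expRK => /(ler_wpM2l (ltW e0)).
  by apply: le_trans; rewrite mulrDr lerD2l mulrC divfK ?gt_eqF.
pose K := [set z : 'rV[R]_d | sqdist 0 z <= R2] `&` [set z | rho <= sqdist 0 z].
have cK : compact K.
  by apply: compact_closedI; [exact: compact_sqdist_le|exact: closed_sqdist_ge].
have Kx : K x by split; exact: ltW.
have cln (z : 'rV[R]_d) : rho <= sqdist 0 z ->
    u w - e * ln (sqdist 0 w) @[w --> z] --> u z - e * ln (sqdist 0 z).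
  move=> rz; have lz : ln (sqdist 0 w) @[w --> z] --> ln (sqdist 0 z).
    exact: (cvg_comp _ _ (@sqdist_continuous R d 0 z)
      (continuous_ln (lt_le_trans rho0 rz))).
  exact: (cvgB (cu z) (cvgM (cvg_cst e) lz)).
have cG : {within K, continuous (fun z => u z - e * ln (sqdist 0 z))}.
  by apply: continuous_in_subspaceT => z; rewrite inE => -[_ /=]; exact: cln.
have [y] := EVT_max_rV (ex_intro _ x Kx) cK cG.
rewrite inE => -[/= y2 y1] ymax'.
have ymax z : rho <= sqdist 0 z -> sqdist 0 z <= R2 ->
    u z - e * ln (sqdist 0 z) <= u y - e * ln (sqdist 0 y).
  by move=> z1 z2; apply: ymax'; rewrite inE.
have y0 : 0 < sqdist 0 y := lt_le_trans rho0 y1.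
have Gy : M - e * ln rho < u y - e * ln (sqdist 0 y).
  apply: lt_le_trans (ymax x (ltW xrho) (ltW xR2)).
  have : e * L = e * ln (sqdist 0 x) - e * ln rho by rewrite /L mulrBr.
  by rewrite eL; clear - Mx; lra.
have {}y1 : rho < sqdist 0 y.
  rewrite lt_neqAle y1 andbT; apply/eqP => E.
  have : u y <= M by apply: uM; rewrite -E.
  by rewrite -E in Gy; clear - Gy; lra.
have {}y2 : sqdist 0 y < R2.
  rewrite lt_neqAle y2 andbT; apply/eqP => E.
  have := ler_norm (- M); rewrite normrN; have := u0 y.
  by rewrite E in Gy; clear - Gy lnR2; lra.
(* The midpoint of [(1 + b) / 2] and 1: above the former the tested bracket is negative, below the
   latter the quadratic bounds [ln]. *)
pose kappa := (3 + b) / 4.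
have kap : 0 <= kappa < 1.
  by rewrite /kappa divr_ge0 ?addr_ge0//= ltr_pdivrMr// mul1r -ltrBrDl; clear - b1; lra.
set T := sqdist 0 y in y0 y1 y2 Gy ymax.
have lnq := @ln_le_quadratic R T kappa y0 kap.
have s0 : e / T != 0 by rewrite gt_eqF// divr_gt0.
have yn0 : y != 0 by rewrite -sqdist_gt0.
have touch : \forall z \near y, u z <= u y + e / T * (sqdist 0 z - sqdist 0 y)
    + - (e * kappa / T ^+ 2) / 2 * (sqdist 0 z - sqdist 0 y) ^+ 2.
  have n1 : \forall z \near y, ln (sqdist 0 z) <= ln T + T^-1 * (sqdist 0 z - T)
      - kappa / T ^+ 2 / 2 * (sqdist 0 z - T) ^+ 2.
    exact: (@sqdist_continuous R d 0 y _ lnq).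
  have n2 : \forall z \near y, rho < sqdist 0 z.
    exact: (cvgr_gt _ (@sqdist_continuous R d 0 y)).
  have n3 : \forall z \near y, sqdist 0 z < R2.
    exact: (cvgr_lt _ (@sqdist_continuous R d 0 y)).
  apply: filterS (filterI n1 (filterI n2 n3)) => z [z1 [z2 z3]].
  have := ymax z (ltW z2) (ltW z3); rewrite -/T.
  have := ler_wpM2l (ltW e0) z1.
  set D := sqdist 0 z - T.
  rewrite (_ : e * (_ + _) = e * ln T + e / T * D
    + - (e * kappa / T ^+ 2) / 2 * D ^+ 2); last by ring.
  by clear; lra.
have := usub y 0 _ _ s0 yn0 touch.
rewrite leNgt => /negP; apply; apply: eikonal_lt0 => //.
rewrite subr0 -/T (_ : _ + _ = e / T * (dot (q y) y * 2 - (b + 1))); last first.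
  by rewrite /kappa; field; rewrite gt_eqF.
have qy := qb y y1.
have eT : 0 < e / T by rewrite divr_gt0.
by rewrite pmulr_rlt0//; clear - qy b1; lra.
Qed.

Lemma liouville gamma q u C (b r : R) : continuous q -> continuous u ->
  quad_sub gamma q u C -> (forall z, C z <= 0) -> (forall z, u z <= 0) ->
  0 <= b < 1 -> 0 <= r -> (forall z, r < enorm z -> dot (q z) z <= b) ->
  exists k, forall z, u z = k.
Proof.
move=> cq cu usub C0 u0 b01 r0 qb; pose rho := r ^+ 2 + 1.
have rho0 : 0 < rho by rewrite ltr_wpDl ?sqr_ge0.
have [||x _ xM] := continuous_max_on u [set z | sqdist 0 z <= rho] _
  (compact_sqdist_le _ _).
- by exists 0; rewrite /= sqdistxx ltW.
- exact: cu.
exists (u x); apply: (strong_maximum gamma q u C x _ cq cu usub C0) => //.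
apply: (exterior_maximum gamma q u C b rho) => // z rz; apply: qb.
rewrite -ltr_sqr ?nnegrE ?enorm_ge0// sqr_enorm.
by rewrite /sqdist subr0 in rz; apply: lt_trans rz; rewrite ltrDl.
Qed.

Lemma at_infinity_le (f : 'rV[R]_d -> R) :
  (limf_esup (fun x => (pos_part (f x))%:E) at_infinity < 1)%E ->
  exists b r, [/\ 0 <= b < 1, 0 <= r & forall x, r < enorm x -> f x <= b].
Proof.
move=> /ereal_inf_lt[_ [A inA <-]] supA.
have [r r0 rA] := at_infinity_ex _ inA.
set S := ereal_sup _ in supA.
have fS x : A x -> ((pos_part (f x))%:E <= S)%E.
  by move=> Ax; apply: ereal_sup_ubound; exists x.
exists (Num.max 0 (fine S)), r; split=> //.
  rewrite le_max lexx gt_max ltr01 /=.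
  by case: S supA {fS} => [s| |]//=; rewrite ?lte_fin// ltr01.
move=> x /rA /fS; case: S supA {fS} => [s _| |]//=.
by rewrite lee_fin le_max => ps; rewrite (le_trans _ ps) ?orbT// le_max lexx.
Qed.

End Liouville.

(** * Conclusion: [theta] tends to 0, then the Liouville property *)

Theorem theorem2p6 (R : realType) (d : nat) (d_gt0 : (0 < d)%N)
  (gamma beta : R)
  (gamma_ge0 : 0 <= gamma) (gamma_le2 : gamma <= 2)
  (beta_gt0 : 0 < beta) (beta_le : beta <= 3 - gamma)
  (q : 'rV[R]_d -> 'rV[R]_d) (q_cont : continuous q)
  (c : 'rV[R]_d -> R) (c_cont : continuous c) (c_lt0 : forall x, c x < 0)
  (V : 'rV[R]_d -> R) (V_ge0 : forall x, 0 <= V x)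
  (V_lip : [locally [lipschitz V x | x in [set: 'rV[R]_d]]])
  (V_liminf : (0 < limf_einf (fun x => (V x)%:E) at_infinity)%E)
  (V_super : visc_supersolution gamma
     (fun x r p => dot (q x) p * enorm p `^ (2 - gamma) + c x * r `^ beta) V)
  (u : 'rV[R]_d -> R) (u_cont : continuous u)
  (u_sub : visc_subsolution gamma
     (fun x r p => dot (q x) p * enorm p `^ (2 - gamma)
                   + c x * pos_part r `^ beta) u)
  (u_V : (fun x => pos_part (u x) / V x) @ at_infinity --> (0 : R)) :
  [/\ (forall x, u x <= 0),
      ((forall x, 0 <= u x) -> forall x, u x = 0) &
      ((limf_esup (fun x => (pos_part (dot (q x) x))%:E) at_infinity < 1)%E ->
        exists k : R, forall x, u x = k)].
Proof.
have u_le0 x : u x <= 0.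
  have uthV theta : 0 < theta <= 1 -> u x <= theta * V x.
    move=> th; have /andP[th0 _] := th.
    have uVth : \forall z \near at_infinity, pos_part (u z) / V z < theta.
      exact: (cvgr_lt _ u_V).
    (* Positivity of [V] far out allows the bound on the quotient to be multiplied out. *)
    have [r r0 rP] := at_infinity_ex _ (filterI (at_infinity_gt V V_liminf) uVth).
    apply: (comparison gamma beta theta (r ^+ 2) q c V u) => //; first exact: sqr_ge0.
    move=> z rz; have [|Vz] := rP z.
      by rewrite -ltr_sqr ?nnegrE ?enorm_ge0// sqr_enorm -[z]subr0.
    rewrite ltr_pdivrMr// => /ltW; apply: le_trans.
    by rewrite le_max lexx.
  rewrite leNgt; apply/negP => ux.
  have V1 : 0 < V x + 1 by rewrite ltr_wpDl.
  (* This choice gives [theta * V x <= u x / 2]; the [+ 1] covers [V x = 0]. *)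
  pose theta := Num.min 1 (u x / (2 * (V x + 1))).
  have th0 : 0 < theta by rewrite lt_min ltr01 divr_gt0// mulr_gt0.
  have th1 : theta <= 1 by rewrite ge_min lexx.
  have : theta * V x <= u x / (2 * (V x + 1)) * (V x + 1).
    by apply: ler_pM; rewrite ?(ltW th0)// ?ge_min ?lexx ?orbT// lerDl.
  rewrite (_ : _ / _ * _ = u x / 2); last by field; rewrite gt_eqF.
  have := uthV theta; rewrite th0 th1 => /(_ isT).
  by clear - ux; lra.
split=> //.
- by move=> u_ge0 x; apply/eqP; rewrite eq_le u_le0 u_ge0.
- move=> /at_infinity_le[b [r [b01 r0 rb]]].
  apply: (liouville gamma q u _ b r q_cont u_cont
    (quad_sub_subsolution _ _ _ _ _ u_sub)) => // z.
  by rewrite nmulr_rle0// powR_ge0.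
Qed.
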